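(* Let $d\in\mathbb{N}$, $\mathcal{L}>0$, $p\in[1,\infty)$, and let $f\in C^{0,1}(\mathbb{R}/\mathcal{L}\mathbb{Z},\mathbb{R}^d)$ be a closed curve embedded in $\mathbb{R}^d$, parametrized by arc-length, with total length $\mathcal{L}$. Assume that a measurable function $\Phi:[0,\infty)\to[0,\infty)$ satisfies the following. (A0) $\Phi(0)=0$, $\Phi$ is of class $C^1$ on $(0,\infty)$, and $\Phi'(x)>0$ for $x>0$. (A1) There exists $K>0$ such that $\lim_{x\to+0}G(x)=K$, where $G(x):=\dfrac{x\Phi'(x)}{\Phi(x)}$. (A2) There exists a measurable function $\varphi:[0,\infty)\to[0,\infty)$ such that $\Phi(kx)\le\varphi(k)\Phi(x)$ for all $k,x\ge0$, and such that $M(a):=\displaystyle\int_0^a\frac{\varphi(t)^p}{t}\,dt$ ($a>0$) satisfies $M(\varepsilon)=o(\varepsilon)$ as $\varepsilon\to+0$ and $M(a)<\infty$ for all $a>0$. (A3) $\displaystyle\int_0^a\frac{t^{2p}}{\Phi(t)^p}\,dt<\infty$ for all $a>0$. Set $\Psi(x):=\left(\dfrac{\Phi(x)}{x^{1/p}}\right)^{1/2}$ for $x>0$. Then the following two properties hold. 1. If $f\in W^{1+\Psi,2p}(\mathbb{R}/\mathcal{L}\mathbb{Z},\mathbb{R}^d)$ and $f$ is bi-Lipschitz continuous, then $\mathcal{E}^{\Phi,p}(f)<\infty$. 2. If $\mathcal{E}^{\Phi,p}(f)<\infty$, then $f$ belongs to $W^{1+\Psi,2p}(\mathbb{R}/\mathcal{L}\mathbb{Z},\mathbb{R}^d)$.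 Moreover, there exists $C>0$ depending only on $p$, $\mathcal{L}$ and $\Phi$ such that $$\|f'\|_{W^{\Psi,2p}}^{2p}\le C\left(\mathcal{E}^{\Phi,p}(f)+\|f'\|_{L^{2p}}\right).$$
   Context: For $s_1,s_2\in\mathbb{R}/\mathcal{L}\mathbb{Z}$, $|s_2-s_1|$ denotes the distance on the circle $\mathbb{R}/\mathcal{L}\mathbb{Z}$ (values in $[0,\mathcal{L}/2]$). ''Closed curve embedded in $\mathbb{R}^d$, parametrized by arc-length'' means that $f:\mathbb{R}/\mathcal{L}\mathbb{Z}\to\mathbb{R}^d$ is injective and $\|f'(s)\|_{\mathbb{R}^d}=1$ for almost every $s$. The intrinsic distance $\mathscr{D}(f(s_1),f(s_2))$ is the length of the shorter of the two arcs of the curve joining $f(s_1)$ and $f(s_2)$, i.e. it equals $|s_2-s_1|$. The energy is $$\mathcal{E}^{\Phi,p}(f):=\iint_{(\mathbb{R}/\mathcal{L}\mathbb{Z})^2}\left(\frac{1}{\Phi(\|f(s_2)-f(s_1)\|_{\mathbb{R}^d})}-\frac{1}{\Phi(\mathscr{D}(f(s_1),f(s_2)))}\right)^p ds_2\,ds_1\in[0,\infty].$$ For $q\in[1,\infty)$, $k\in\mathbb{N}\cup\{0\}$ and a measurable function $\Psi$, the space $W^{k+\Psi,q}(\mathbb{R}/\mathcal{L}\mathbb{Z},\mathbb{R}^d)$ is the set of $f$ in the usual Sobolev space $W^{k,q}(\mathbb{R}/\mathcal{L}\mathbb{Z},\mathbb{R}^d)$ (with $W^{0,q}=L^q$) such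 that $[f^{(k)}]_{\Psi,q}<\infty$, where $$[g]_{\Psi,q}:=\left(\iint_{(\mathbb{R}/\mathcal{L}\mathbb{Z})^2}\frac{\|g(s_2)-g(s_1)\|_{\mathbb{R}^d}^q}{\Psi(|s_2-s_1|)^q}\,\frac{1}{|s_2-s_1|}\,ds_2\,ds_1\right)^{1/q},$$ with norm $\|f\|_{W^{k+\Psi,q}}:=\|f\|_{W^{k,q}}+[f^{(k)}]_{\Psi,q}$. In particular $\|g\|_{W^{\Psi,2p}}=\|g\|_{L^{2p}}+[g]_{\Psi,2p}$. (The value of $\Psi$ at $0$ is immaterial.) $f$ is bi-Lipschitz continuous if it is Lipschitz and there exists $C_b>0$ such that $\|f(s_2)-f(s_1)\|_{\mathbb{R}^d}\ge C_b\,\mathscr{D}(f(s_1),f(s_2))$ for all $s_1,s_2\in\mathbb{R}/\mathcal{L}\mathbb{Z}$. *)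

(* Defs.v *)
From HB Require Import structures.
From mathcomp Require Import all_boot all_order all_algebra.
From mathcomp Require Import all_classical all_reals all_analysis.

Set Implicit Arguments.
Unset Strict Implicit.
Unset Printing Implicit Defensive.

Import Order.TTheory GRing.Theory Num.Theory.
Import numFieldNormedType.Exports.

Local Open Scope classical_set_scope.
Local Open Scope ring_scope.

(* Functions on the circle R/LZ are L-periodic functions on R, and integrals
   over the circle are integrals over the fundamental domain [0, L[.
   Vectors of R^d are row vectors; the library norm on 'rV[R]_d is the sup norm,
   so the Euclidean norm is introduced separately. *)

Section Defs.
Context {R : realType}.
Implicit Types (L p q : R) (Phi Psi phi : R -> R) (d k : nat).

Local Notation mu := (@lebesgue_measure R).

Definition enorm d (v : 'rV[R]_d) : R := Num.sqrt (\sum_(i < d) v ord0 i ^+ 2).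

(* representative of x modulo L in [0, L[, for L > 0 *)
Definition circ_mod L (x : R) : R := x - L * (Num.floor (x / L))%:~R.

(* |t - s|, the distance on R/LZ *)
Definition circ_dist L (s t : R) : R :=
  Num.min (circ_mod L (t - s)) (L - circ_mod L (t - s)).

Definition circ_lipschitz L d (f : R -> 'rV[R]_d) : Prop :=
  exists K : R, forall s t, enorm (f t - f s) <= K * circ_dist L s t.

(* length of the arc f([a, b]) of a Lipschitz curve *)
Definition arc_length d (f : R -> 'rV[R]_d) (a b : R) : \bar R :=
  \int[mu]_(s in `[a, b]) (enorm (f^`()%classic s))%:E.

(* Distance between f s and f t along the curve: the two arcs joining them are
   the images of [s, s + r] and [s + r, s + L], where r = (t - s) mod L. *)
Definition intrinsic_dist L d (f : R -> 'rV[R]_d) (s t : R) : R :=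
  let r := circ_mod L (t - s) in
  fine (Order.min (arc_length f s (s + r)) (arc_length f (s + r) (s + L))).

Record arclength_embedded L d (f : R -> 'rV[R]_d) : Prop := ArclengthEmbedded {
  curve_periodic : periodic f L;
  curve_lipschitz : circ_lipschitz L f;
  curve_injective : {in `[0, L[ &, injective f};
  curve_unit_speed :
    {ae mu, forall s : R, derivable f s 1 /\ enorm (f^`()%classic s) = 1};
  curve_length : arc_length f 0 L = L%:E
}.

Definition bilipschitz L d (f : R -> 'rV[R]_d) : Prop :=
  circ_lipschitz L f /\
  exists Cb : R, 0 < Cb /\
    forall s t, Cb * intrinsic_dist L f s t <= enorm (f t - f s).

(* On the diagonal, which is null, the integrand is 0 since 0^-1 = 0. *)
Definition energy Phi p L d (f : R -> 'rV[R]_d) : \bar R :=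
  \int[(mu \x mu)%E]_(z in `[0, L[ `*` `[0, L[)
    (((Phi (enorm (f z.2 - f z.1)))^-1
      - (Phi (intrinsic_dist L f z.1 z.2))^-1) `^ p)%:E.

Definition norm_Lq L q d (g : R -> 'rV[R]_d) : \bar R :=
  ((\int[mu]_(s in `[0%R, L[) (enorm (g s) `^ q)%:E) `^ (q^-1)%R)%E.

(* Borel measurable: every class of the usual L^q has such a representative. *)
Definition in_Lq L q d (g : R -> 'rV[R]_d) : Prop :=
  [/\ periodic g L,
      forall i : 'I_d, measurable_fun setT (fun s => g s ord0 i)
    & (norm_Lq L q g < +oo)%E].

(* g is the k-th weak derivative of f on R/LZ *)
Definition weak_deriv L k d (f g : R -> 'rV[R]_d) : Prop :=
  forall eta : R -> R, periodic eta L ->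
    (forall n (s : R), derivable (eta^`(n)%classic) s 1) ->
    forall i : 'I_d,
      (\int[mu]_(s in `[0%R, L[) (eta^`(k)%classic s * f s ord0 i)%:E =
       ((-1) ^+ k)%:E * \int[mu]_(s in `[0%R, L[) (eta s * g s ord0 i)%:E)%E.

Definition in_Wkq L k q d (f : R -> 'rV[R]_d) : Prop :=
  in_Lq L q f /\
  forall j, (j <= k)%N ->
    exists g : R -> 'rV[R]_d, in_Lq L q g /\ weak_deriv L j f g.

(* the seminorm [g]_{Psi,q} *)
Definition seminorm_Psi L Psi q d (g : R -> 'rV[R]_d) : \bar R :=
  ((\int[(mu \x mu)%E]_(z in `[0%R, L[ `*` `[0%R, L[)
      (enorm (g z.2 - g z.1) `^ q / Psi (circ_dist L z.1 z.2) `^ q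
       * (circ_dist L z.1 z.2)^-1)%:E) `^ (q^-1)%R)%E.

(* membership in W^{k+Psi,q}; the weak derivative g stands for f^(k) *)
Definition in_WkPsi L k Psi q d (f : R -> 'rV[R]_d) : Prop :=
  in_Wkq L k q f /\
  exists g : R -> 'rV[R]_d,
    [/\ in_Lq L q g, weak_deriv L k f g & (seminorm_Psi L Psi q g < +oo)%E].

(* the norm of W^{Psi,q}, that is, of W^{k+Psi,q} for k = 0 *)
Definition norm_WPsi L Psi q d (g : R -> 'rV[R]_d) : \bar R :=
  (norm_Lq L q g + seminorm_Psi L Psi q g)%E.

(* M(a) = int_0^a phi(t)^p / t dt *)
Definition Mint phi p (a : R) : \bar R :=
  \int[mu]_(t in `]0, a]) (phi t `^ p / t)%:E.

(* Psi(x) = (Phi(x) / x^(1/p))^(1/2) *)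
Definition Psi_of Phi p (x : R) : R := (Phi x / x `^ p^-1) `^ 2^-1.

End Defs.

(* Main.v *)
Require Import Defs.
From HB Require Import structures.
From mathcomp Require Import all_boot all_order all_algebra.
From mathcomp Require Import all_classical all_reals all_analysis.
From mathcomp Require Import measurable_realfun ring lra.

(** For a curve of unit speed, let q(s, w) = (f(s + w) - f(s)) / w be the secant
    ([secant]) and v = f' the velocity ([velocity]). Unfolding the torus along
    its diagonal ([ge0_integral_circle]) turns the energy and the seminorm of v
    into integrals over the increment w, with |w| < L/2, and over s. The power
    2p of the seminorm has the integrand |v(s + w) - v(s)|^(2p) with the weight
    Phi(|w|)^-p. The assumption on x Phi'(x) / Phi(x) bounds this logarithmic
    slope between positive constants on ]0, L/2], so that by the mean value
    theorem the integrand of the energy is comparable to the power p of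
    (1 - |q|) / Phi(|w|): always from below ([inv_Phi_ge]), and from above when
    f is bi-Lipschitz ([inv_Phi_le]). The theorem compares the shortening
    1 - |q| of the chords with the oscillation of v.

    From the seminorm to the energy. Since |v| = 1, the shortening 1 - |q(s, w)|
    is at most half the average over b in [0, 1] of |v(s + b w) - v(s)|^2
    ([secant_defect_le]). By Jensen's inequality and Tonelli's theorem, the
    energy is bounded by an integral over b of rescaled seminorms, and rescaling
    by b costs a factor phi(b)^p / b ([wint_scale]), which is integrable
    ([energy_lty]).

    From the energy to the seminorm. The secant q(s, w) is a convex combination
    of q(s, e w) and of another vector of the unit ball, with weights e and
    1 - e. The ball being uniformly convex ([enorm_convex]), the shortening
    controls |q(s, w) - q(s, e w)|^2, so that the energy bounds the weighted
    integral of |q(s, w) - q(s, e w)|^(2p) ([energy_ge]). As M(a) = o(a), some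
    ratio e makes phi(e)^p / e as small as needed ([small_ratio]): passing from
    one scale to the next then divides the weighted integral by a large factor,
    and summing over the scales w, e w, e^2 w, ... bounds the integral of
    |q(s, w) - q(s, e^n w)|^(2p) uniformly in n ([iterated_gap_le]). Fatou's
    lemma replaces q(s, e^n w) by v(s) ([tangent_gap_le]). Finally
    v(s + w) - v(s) is the difference of the deviations from the common secant
    at the two ends of the chord ([velocity_increment_le]).

    It remains to see that the seminorm of the weak derivative is that of v. A
    Lipschitz function is the integral of its derivative ([lipschitz_FTC]), so
    that v is a weak derivative by integration by parts; and weak derivatives
    are unique almost everywhere, as smooth periodic functions approximate the
    indicators of intervals ([weak_deriv_unique]). *)

Set Implicit Arguments.
Unset Strict Implicit.
Unset Printing Implicit Defensive.

Import Order.TTheory GRing.Theory Num.Theory.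
Import numFieldNormedType.Exports.

Local Open Scope classical_set_scope.
Local Open Scope ring_scope.

(** * Affine changes of variables and integrals of non-measurable functions *)
Section Affine.
Context {R : realType}.
Local Notation mu := (@lebesgue_measure R).

Lemma measurable_affine (a c : R) :
  measurable_fun setT ((fun x => a * x + c) : measurableTypeR R -> measurableTypeR R).
Proof. by apply: measurable_funD => //; exact: mulrl_measurable. Qed.

(** A multiple of the image measure agrees with the Lebesgue measure on half-open
    intervals, which determines it. *)
Lemma lebesgue_measure_affine (a c : R) (A : set R) : a != 0 -> measurable A ->
  mu ((fun x => a * x + c) @^-1` A) = (`|a|^-1%:E * mu A)%E.
Proof.
move=> a0 mA.
have na0 : 0 < `|a| by rewrite normr_gt0.
have itvE (i : interval R) : mu [set` i] = _ := lebesgue_measure_itv i.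
pose phi : measurableTypeR R -> measurableTypeR R := fun x => a * x + c.
have mphi : measurable_fun setT phi by exact: measurable_affine.
pose phim : {mfun measurableTypeR R >-> measurableTypeR R} := HB.pack phi (isMeasurableFun.Build _ _ _ _ _ mphi).
have := @lebesgue_measure_unique R (mscale (NngNum (normr_ge0 a)) (pushforward mu phim)).
move=> /(_ mphi _ A mA) ->; last first.
  move=> _ [[u v]] _ <-.
  change (mu `]u, v]%classic = (`|a|%:E * mu (phi @^-1` `]u, v]%classic))%E).
  have [ap|an] : 0 < a \/ a < 0.
    by case: (ltgtP a 0) a0 => //; [right|left].
    have -> : phi @^-1` `]u, v]%classic = `](u - c) / a, (v - c) / a]%classic.
      apply/seteqP; split => x /=; by rewrite !in_itv/= /phi ltr_pdivrMr// ler_pdivlMr// ltrBlDr lerBrDr (mulrC x).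
    rewrite !itvE/= !lte_fin ltr_pM2r ?invr_gt0// ltrD2r.
    case: ifPn => _; last by rewrite mule0.
    by rewrite -!EFinB -EFinM gtr0_norm//; congr (_%:E); field; rewrite gt_eqF.
  have -> : phi @^-1` `]u, v]%classic = `[(v - c) / a, (u - c) / a[%classic.
    apply/seteqP; split => x /=; by rewrite !in_itv/= /phi ltr_ndivlMr// ler_ndivrMr// ltrBlDr lerBrDr (mulrC x) andbC.
  rewrite !itvE/= !lte_fin ltr_nM2r ?invr_lt0// ltrD2r.
  case: ifPn => _; last by rewrite mule0.
  by rewrite -!EFinB -EFinM ltr0_norm//; congr (_%:E); field; rewrite lt_eqF.
change (mu (phi @^-1` A) = (`|a|^-1%:E * (`|a|%:E * mu (phi @^-1` A)))%E).
by rewrite muleA -EFinM mulVf ?gt_eqF// mul1e.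
Qed.

Lemma ge0_integral_affine (a c : R) (D : set R) (f : R -> \bar R) : a != 0 ->
  measurable D -> measurable_fun setT f -> (forall x, (0 <= f x)%E) ->
  (\int[mu]_(x in (fun x => (a * x + c)%R) @^-1` D) f (a * x + c)%R =
   `|a|^-1%:E * \int[mu]_(x in D) f x)%E.
Proof.
move=> a0 mD mf f0.
pose phi : measurableTypeR R -> measurableTypeR R := fun x => a * x + c.
have mphi : measurable_fun setT phi by exact: measurable_affine.
have := @ge0_integral_pushforward _ _ _ _ R phi mphi mu D f mD.
move=> /(_ (measurable_funTS mf)); rewrite /comp/= => <-; last by move=> x _.
have ia0 : 0 <= `|a|^-1 by rewrite invr_ge0.
rewrite -[(`|a|^-1)%R]/((NngNum ia0)%:num) -ge0_integral_mscale//; last exact: measurable_funTS.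
pose phim : {mfun measurableTypeR R >-> measurableTypeR R} := HB.pack phi (isMeasurableFun.Build _ _ _ _ _ mphi).
apply: (@eq_measure_integral _ _ _ _ (mscale (NngNum ia0) mu) (pushforward mu phim)) => A mA _.
exact: (lebesgue_measure_affine c a0 mA).
Qed.

Lemma ae_affine (a c : R) (P : R -> Prop) : a != 0 ->
  {ae mu, forall x, P x} -> {ae mu, forall x, P (a * x + c)}.
Proof.
move=> a0 [N [mN N0 PN]]; exists ((fun x => a * x + c) @^-1` N); split.
- by rewrite -[X in measurable X]setTI; exact: measurable_affine.
- by rewrite lebesgue_measure_affine// N0 mule0.
- by move=> x /= nP; apply: PN.
Qed.

End Affine.

Section Lower.
Local Open Scope ereal_scope.
Context d (T : measurableType d) (R : realType) (mu : {measure set T -> \bar R}).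

(** By definition a supremum over the simple functions below the integrand,
    whether the latter is measurable or not. *)
Lemma ge0_le_integral_nomeas (D : set T) (f g : T -> \bar R) :
  (forall x, D x -> 0 <= f x) -> (forall x, D x -> f x <= g x) ->
  \int[mu]_(x in D) f x <= \int[mu]_(x in D) g x.
Proof.
move=> f0 fg; rewrite !ge0_integralE//; last by move=> x Dx; exact: le_trans (f0 _ Dx) (fg _ Dx).
apply: ereal_sup_le => _ [h /= hf <-]; exists h => //= x; apply: le_trans (hf x) _.
rewrite !patchE; case: ifPn => // /set_mem Dx; exact: fg.
Qed.

(** Replacing g by +oo or by 0 on the exceptional null set gives measurable
    functions above and below f, with the same integral as g. *)
Lemma ge0_ae_eq_integral_nomeas (D : set T) (f g : T -> \bar R) :
  measurable D -> measurable_fun D g ->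
  (forall x, D x -> 0 <= f x) -> (forall x, D x -> 0 <= g x) ->
  {ae mu, forall x, D x -> f x = g x} ->
  \int[mu]_(x in D) f x = \int[mu]_(x in D) g x.
Proof.
move=> mD mg f0 g0 [N [mN N0 fgN]]; apply/eqP; rewrite eq_le; apply/andP; split.
  pose h x := if x \in N then +oo else g x.
  have mh : measurable_fun D h.
    apply: measurable_fun_if => //.
      apply: (measurable_fun_bool true).
      rewrite [X in measurable (_ `&` X)](_ : _ = N); first exact: measurableI.
      by apply/seteqP; split => x /=; [exact: set_mem|exact: mem_set].
    by apply: measurable_funS mg => //; exact: subIsetl.
  have -> : \int[mu]_(x in D) g x = \int[mu]_(x in D) h x.
    apply: ge0_ae_eq_integral => //.
      by move=> x Dx; rewrite /h; case: ifPn => // _; exact: g0.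
    exists N; split => // x /= /not_implyP[Dx nE]; apply: contrapT => xN; apply: nE.
    by rewrite /h ifF//; apply/negbTE; rewrite notin_setE.
  apply: ge0_le_integral_nomeas => // x Dx; rewrite /h; case: ifPn => [_|]; first exact: leey.
  rewrite notin_setE => xN; have [->//|fg] := pselect (f x = g x).
  by exfalso; apply: xN; apply: fgN => /= fgE; apply: fg; exact: fgE.
pose h x := if x \in N then 0 else g x.
have mh : measurable_fun D h.
  apply: measurable_fun_if => //.
    apply: (measurable_fun_bool true).
    rewrite [X in measurable (_ `&` X)](_ : _ = N); first exact: measurableI.
    by apply/seteqP; split => x /=; [exact: set_mem|exact: mem_set].
  by apply: measurable_funS mg => //; exact: subIsetl.
have -> : \int[mu]_(x in D) g x = \int[mu]_(x in D) h x.
  apply: ge0_ae_eq_integral => //.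
    by move=> x Dx; rewrite /h; case: ifPn => // _; exact: g0.
  exists N; split => // x /= /not_implyP[Dx nE]; apply: contrapT => xN; apply: nE.
  by rewrite /h ifF//; apply/negbTE; rewrite notin_setE.
apply: ge0_le_integral_nomeas => [x Dx|x Dx]; rewrite /h; case: ifPn => [_|] //.
- by move=> _; exact: g0.
- exact: f0.
- rewrite notin_setE => xN; have [->//|fg] := pselect (f x = g x).
  by exfalso; apply: xN; apply: fgN => /= fgE; apply: fg; exact: fgE.
Qed.

End Lower.

(** * Tonelli's theorem on rectangles and integration on the circle *)
Section Tonelli.
Local Open Scope ereal_scope.
Context d1 d2 (T1 : measurableType d1) (T2 : measurableType d2) (R : realType).
Variables (m1 : {sigma_finite_measure set T1 -> \bar R})
          (m2 : {sigma_finite_measure set T2 -> \bar R}).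
Variables (D1 : set T1) (D2 : set T2) (F : T1 * T2 -> \bar R).
Hypotheses (mD1 : measurable D1) (mD2 : measurable D2)
  (mF : measurable_fun setT F) (F0 : forall z, 0 <= F z).

Lemma measurable_integral_section :
  measurable_fun setT (fun x => \int[m2]_(y in D2) F (x, y)).
Proof.
have mX : measurable ([set: T1] `*` D2) by exact: measurableX.
have mFX : measurable_fun setT (F \_ ([set: T1] `*` D2)).
  by apply/(measurable_restrictT _ mX); exact: measurable_funTS.
have := @measurable_fun_fubini_tonelli_F _ _ T1 T2 R m2 _ mFX.
rewrite (_ : fubini_F _ _ = (fun x => \int[m2]_(y in D2) F (x, y))).
  by apply; apply: erestrict_ge0.
apply/funext => x; rewrite /fubini_F [RHS]integral_mkcond; apply: eq_integral => y _.
by rewrite !patchE in_setX in_setT.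
Qed.

Lemma tonelli_setX :
  \int[m1 \x m2]_(z in D1 `*` D2) F z = \int[m1]_(x in D1) \int[m2]_(y in D2) F (x, y).
Proof.
have mX : measurable (D1 `*` D2) by exact: measurableX.
rewrite integral_mkcond fubini_tonelli1; last 2 first.
  by apply/(measurable_restrictT _ mX); exact: measurable_funTS.
  by apply: erestrict_ge0.
rewrite [RHS]integral_mkcond; apply: eq_integral => x _; rewrite /fubini_F patchE.
case: ifPn => xD1; last first.
  by apply: integral0_eq => y _; rewrite patchE in_setX (negbTE xD1).
by rewrite [RHS]integral_mkcond; apply: eq_integral => y _; rewrite !patchE in_setX xD1.
Qed.

Lemma tonelli_set_swap :
  \int[m1]_(x in D1) \int[m2]_(y in D2) F (x, y) =
  \int[m2]_(y in D2) \int[m1]_(x in D1) F (x, y).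
Proof.
have mX : measurable (D1 `*` D2) by exact: measurableX.
rewrite -tonelli_setX integral_mkcond fubini_tonelli2; last 2 first.
  by apply/(measurable_restrictT _ mX); exact: measurable_funTS.
  by apply: erestrict_ge0.
rewrite [RHS]integral_mkcond; apply: eq_integral => y _; rewrite /fubini_G patchE.
case: ifPn => yD2; last first.
  by apply: integral0_eq => x _; rewrite patchE in_setX (negbTE yD2) andbF.
rewrite [RHS]integral_mkcond; apply: eq_integral => x _; rewrite !patchE in_setX yD2.
by rewrite andbT.
Qed.
End Tonelli.

Section Periodic.
Context {R : realType}.
Local Notation mu := (@lebesgue_measure R).

Lemma ge0_integral_shift (c a b : R) (f : R -> \bar R) :
  measurable_fun setT f -> (forall x, (0 <= f x)%E) ->
  (\int[mu]_(x in `[a, b[) f (x + c)%R = \int[mu]_(x in `[(a + c)%R, (b + c)%R[) f x)%E.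
Proof.
move=> mf f0; have := @ge0_integral_affine R 1 c `[a + c, b + c[%classic f (oner_neq0 _).
rewrite normr1 invr1 mul1e => <- //.
rewrite [X in (integral _ X _ = _)%E](_ : _ = (fun x : R => 1 * x + c) @^-1` `[a + c, b + c[%classic); last first.
  by apply/seteqP; split => x /=; rewrite !in_itv/= mul1r lerD2r ltrD2r.
by apply: eq_integral => x _; rewrite mul1r.
Qed.

Lemma ge0_integral_scale (k r : R) (f : R -> \bar R) : 0 < k ->
  measurable_fun setT f -> (forall x, (0 <= f x)%E) ->
  (\int[mu]_(x in `](- r)%R, r[) f (k * x)%R =
   k^-1%:E * \int[mu]_(x in `](- (k * r))%R, (k * r)%R[) f x)%E.
Proof.
move=> k0 mf f0.
have := @ge0_integral_affine R k 0 `](- (k * r))%R, (k * r)%R[%classic f (lt0r_neq0 k0).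
rewrite gtr0_norm// => <- //.
rewrite [X in (integral _ X _ = _)%E](_ : _ = (fun x : R => k * x + 0) @^-1` `](- (k * r))%R, (k * r)%R[%classic); last first.
  by apply/seteqP; split => x /=; rewrite !in_itv/= addr0 -mulrN !ltr_pM2l.
by apply: eq_integral => x _; rewrite addr0.
Qed.

Lemma ge0_integral_opp (r : R) (f : R -> \bar R) :
  measurable_fun setT f -> (forall x, (0 <= f x)%E) ->
  (\int[mu]_(x in `](- r)%R, r[) f (- x)%R = \int[mu]_(x in `](- r)%R, r[) f x)%E.
Proof.
move=> mf f0.
have N10 : (-1 : R) != 0 by rewrite oppr_eq0 oner_neq0.
have := @ge0_integral_affine R (-1) 0 `](- r)%R, r[%classic f N10.
rewrite normrN normr1 invr1 mul1e => <- //.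
rewrite [X in (integral _ X _ = _)%E](_ : _ = (fun x : R => -1 * x + 0) @^-1` `](- r)%R, r[%classic); last first.
  by apply/seteqP; split => x /=; rewrite !in_itv/= addr0 mulN1r ltrN2 ltrNl andbC.
by apply: eq_integral => x _; rewrite addr0 mulN1r.
Qed.

Lemma periodicMz (T : Type) (L : R) (P : R -> T) (n : int) (x : R) :
  (forall x, P (x + L) = P x) -> P (x + n%:~R * L) = P x.
Proof.
move=> PL; have H (m : nat) y : P (y + m%:R * L) = P y.
  elim: m y => [|m IH] y; first by rewrite mul0r addr0.
  by rewrite -natr1 mulrDl mul1r addrA PL IH.
case: n => m; first exact: H.
by rewrite NegzE mulrNz mulNr -[LHS](H m.+1) subrK.
Qed.

Lemma ge0_integral_period (L a : R) (f : R -> \bar R) : 0 < L ->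
  measurable_fun setT f -> (forall x, (0 <= f x)%E) ->
  (forall x, f (x + L) = f x) ->
  (\int[mu]_(x in `[a, (a + L)%R[) f x = \int[mu]_(x in `[0%R, L[) f x)%E.
Proof.
move=> L0 mf f0 fL.
set n := Num.floor (a / L); set r := a - n%:~R * L.
have r0 : 0 <= r.
  by rewrite /r subr_ge0 -ler_pdivlMr// ge_floor.
have rL : r < L.
  have := floorD1_gt (a / L); rewrite -/n intrD ltr_pdivrMr// /r => aL.
  by rewrite ltrBlDr -[X in X + _]mul1r -mulrDl addrC.
have ar : a = r + n%:~R * L by rewrite /r subrK.
clearbody r n; subst a.
have -> : (\int[mu]_(x in `[(r + n%:~R * L)%R, (r + n%:~R * L + L)%R[) f x = \int[mu]_(x in `[r, (r + L)%R[) f x)%E.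
  rewrite addrAC -ge0_integral_shift//.
  by apply: eq_integral => x _; rewrite periodicMz.
have Hs (b c e : R) : b <= c -> c <= e ->
  (\int[mu]_(x in `[b, e[) f x = \int[mu]_(x in `[b, c[) f x + \int[mu]_(x in `[c, e[) f x)%E.
  move=> bc ce; rewrite -ge0_integral_setU//=.
  - congr (integral _ _ _); apply/seteqP; split => x /=; rewrite !in_itv/=.
      move=> /andP[bx xe]; case: (ltP x c) => xc; [left|right]; first by rewrite bx.
      by rewrite xe.
    move=> [/andP[-> xc]|/andP[cx ->]]; first exact: lt_le_trans xc ce.
    by rewrite (le_trans bc cx).
  - exact: measurable_funTS.
  - apply/disj_setPS => x /=; rewrite !in_itv/= => -[/andP[_ xc] /andP[cx _]].
    by have := lt_le_trans xc cx; rewrite ltxx.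
rewrite (Hs r L (r + L))//; [|exact: ltW|by rewrite lerDr].
rewrite (Hs 0 r L)//; last exact: ltW.
rewrite addeC; congr (_ + _)%E.
rewrite -[X in `[X, _[]add0r -ge0_integral_shift//.
by apply: eq_integral => x _; rewrite fL.
Qed.

(** Unfolding the torus along its diagonal: for fixed s, the second variable runs
    over a period, which may be centred at s. *)
Lemma ge0_integral_circle (L : R) (F : R * R -> \bar R) : 0 < L ->
  measurable_fun setT F -> (forall z, (0 <= F z)%E) ->
  (forall s t, F (s, t + L) = F (s, t)) ->
  (\int[mu \x mu]_(z in `[0%R, L[ `*` `[0%R, L[) F z =
   \int[mu]_(w in `](- (L / 2))%R, (L / 2)%R[) \int[mu]_(s in `[0%R, L[) F (s, (s + w)%R))%E.
Proof.
move=> L0 mF F0 FL.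
have mFs s : measurable_fun setT (fun t => F (s, t)) by exact: measurable_fun_pair2.
pose G (z : R * R) := F (z.1, z.1 + z.2).
have mG : measurable_fun setT G.
  apply: measurableT_comp mF _; apply: measurable_fun_pair => //.
  exact: (@measurable_funD _ _ _ _ fst snd).
transitivity (\int[mu]_(s in `[0%R, L[) \int[mu]_(w in `](- (L / 2))%R, (L / 2)%R[) G (s, w))%E.
  rewrite tonelli_setX//; apply: eq_integral => s _.
  rewrite -(@ge0_integral_period L (s - L / 2))//.
  rewrite integral_itv_obnd_cbnd; last by apply: measurable_funTS; exact: measurable_fun_pair2.
  rewrite /G/=; under [RHS]eq_integral do rewrite addrC.
  rewrite (@ge0_integral_shift s _ _ (fun t => F (s, t)))//.
  have -> : - (L / 2) + s = s - L / 2 by rewrite addrC.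
  by have -> : L / 2 + s = s - L / 2 + L by field.
rewrite tonelli_set_swap//.
by move=> z; exact: F0.
Qed.
End Periodic.

(** * Powers, Jensen's inequality and Euclidean geometry *)
Section Powers.
Context {R : realType}.
Implicit Types y p q m : R.

Lemma powRD_le (x y q : R) : 0 <= x -> 0 <= y -> 0 <= q ->
  (x + y) `^ q <= 2 `^ q * (x `^ q + y `^ q).
Proof.
move=> x0 y0 q0.
wlog xy : x y x0 y0 / x <= y.
  move=> H; case: (leP x y) => [|/ltW] xy; first exact: H.
  by rewrite addrC [X in _ <= _ * X]addrC; exact: H.
apply: (@le_trans _ _ ((2 * y) `^ q)).
  by rewrite ge0_ler_powR// ?nnegrE ?addr_ge0 ?mulr_ge0//; lra.
by rewrite powRM// ler_wpM2l ?powR_ge0// lerDr powR_ge0.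
Qed.

(** Young's inequality with conjugate exponents p and p / (p - 1): the power
    function lies above its tangent line at m. *)
Lemma powR_tangent y m p : 0 <= y -> 0 <= m -> 1 <= p ->
  p * m `^ (p - 1) * y <= y `^ p + (p - 1) * m `^ p.
Proof.
move=> y0 m0; rewrite le_eqVlt => /predU1P[<-|p1].
  by rewrite subrr powRr0 mul0r addr0 powRr1// !mul1r.
have p0 : 0 < p by lra.
have p10 : 0 < p - 1 by lra.
have q0 : 0 < p / (p - 1) by rewrite divr_gt0.
have pq : p^-1 + (p / (p - 1))^-1 = 1 by field; rewrite ?gt_eqF.
have := conjugate_powR y0 (powR_ge0 m (p - 1)) p0 q0 pq.
rewrite -powRrM mulrCA divff ?gt_eqF// mulr1 => H.
have : p * (y * m `^ (p - 1)) <= p * (y `^ p / p + m `^ p / (p / (p - 1))).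
  by rewrite ler_pM2l.
have -> : p * (y `^ p / p + m `^ p / (p / (p - 1))) = y `^ p + (p - 1) * m `^ p.
  by field; rewrite ?gt_eqF.
by have -> : p * m `^ (p - 1) * y = p * (y * m `^ (p - 1)) by ring.
Qed.

(** Jensen's inequality for the p-th power: integrate the tangent line of
    y |-> y ^ p at the mean value. *)
Lemma jensen_powR d (T : measurableType d) (mu : {measure set T -> \bar R})
  (D : set T) (h : T -> R) m p : measurable D -> mu D = 1%E -> 1 <= p ->
  measurable_fun setT h -> (forall x, 0 <= h x) ->
  (\int[mu]_(x in D) (h x)%:E = m%:E)%E ->
  ((m `^ p)%:E <= \int[mu]_(x in D) (h x `^ p)%:E)%E.
Proof.
move=> mD D1 p1 mh h0 hm.
have p0 : 0 <= p by lra.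
have p10 : 0 <= p - 1 by lra.
have m0 : 0 <= m by rewrite -lee_fin -hm; apply: integral_ge0 => x _; rewrite lee_fin.
have mhp : measurable_fun D (fun x => (h x `^ p)%:E).
  by apply/measurable_EFinP/measurable_funTS; exact: measurableT_comp (measurable_powR p) mh.
have c0 : 0 <= p * m `^ (p - 1) by rewrite mulr_ge0 ?powR_ge0.
have : (\int[mu]_(x in D) ((p * m `^ (p - 1) * h x)%:E) <=
        \int[mu]_(x in D) ((h x `^ p)%:E + ((p - 1) * m `^ p)%:E))%E.
  apply: ge0_le_integral => //.
  - by move=> x _; rewrite lee_fin mulr_ge0.
  - by apply/measurable_EFinP; apply: measurable_funM => //; exact: measurable_funTS.
  - exact: emeasurable_funD.
  - by move=> x _; rewrite -EFinD lee_fin powR_tangent.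
under eq_integral do rewrite EFinM.
rewrite ge0_integralZl_EFin//; last 2 first.
- by move=> x _; rewrite lee_fin.
- by apply/measurable_EFinP; exact: measurable_funTS.
rewrite hm ge0_integralD//; last 2 first.
- by move=> x _; rewrite lee_fin powR_ge0.
- by move=> x _; rewrite lee_fin mulr_ge0 ?powR_ge0.
rewrite integral_cst// D1 mule1 -EFinM.
have -> : p * m `^ (p - 1) * m = m `^ p + (p - 1) * m `^ p.
  have [->|/eqP mn0] := eqVneq m 0.
    by rewrite mulr0 powR0 ?mulr0 ?addr0// gt_eqF//; lra.
  rewrite -mulrA (mulrC (m `^ _)) mulr_powRB1//; [by ring|lra].
rewrite EFinD leeD2rE//.
Qed.

End Powers.

Section Euclid.
Context {R : realType} {d : nat}.
Implicit Types u v : 'rV[R]_d.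

Definition dot u v : R := \sum_(i < d) u ord0 i * v ord0 i.

Lemma dotC u v : dot u v = dot v u.
Proof. by apply: eq_bigr => i _; rewrite mulrC. Qed.

Lemma dotDl u v w : dot (u + v) w = dot u w + dot v w.
Proof. by rewrite -big_split; apply: eq_bigr => i _; rewrite mxE mulrDl. Qed.

Lemma dotZl a u v : dot (a *: u) v = a * dot u v.
Proof. by rewrite /dot mulr_sumr; apply: eq_bigr => i _; rewrite mxE mulrA. Qed.

Lemma dotNl u v : dot (- u) v = - dot u v.
Proof. by rewrite -scaleN1r dotZl mulN1r. Qed.

Lemma dotDr u v w : dot w (u + v) = dot w u + dot w v.
Proof. by rewrite dotC dotDl !(dotC w). Qed.

Lemma dotZr a u v : dot u (a *: v) = a * dot u v.
Proof. by rewrite dotC dotZl (dotC u). Qed.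

Lemma dotNr u v : dot u (- v) = - dot u v.
Proof. by rewrite dotC dotNl (dotC u). Qed.

Lemma dotuu_ge0 u : 0 <= dot u u.
Proof. by apply: sumr_ge0 => i _; rewrite -expr2 sqr_ge0. Qed.

Lemma enormE u : enorm u = Num.sqrt (dot u u).
Proof. by congr Num.sqrt; apply: eq_bigr => i _; rewrite expr2. Qed.

Lemma enorm_ge0 u : 0 <= enorm u.
Proof. exact: sqrtr_ge0. Qed.

Lemma enorm_sqr u : enorm u ^+ 2 = dot u u.
Proof. by rewrite enormE sqr_sqrtr// dotuu_ge0. Qed.

Lemma enorm0 : enorm (0 : 'rV[R]_d) = 0.
Proof. by rewrite enormE -(scale0r 0) dotZl mul0r sqrtr0. Qed.

Lemma enormZ a u : enorm (a *: u) = `|a| * enorm u.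
Proof. by rewrite !enormE dotZl dotZr mulrA -expr2 sqrtrM ?sqr_ge0// sqrtr_sqr. Qed.

Lemma enormN u : enorm (- u) = enorm u.
Proof. by rewrite -scaleN1r enormZ normrN normr1 mul1r. Qed.

Lemma enormB u v : enorm (u - v) = enorm (v - u).
Proof. by rewrite -opprB enormN. Qed.

Lemma enorm_eq0 u : enorm u = 0 -> u = 0.
Proof.
move=> u0; have := enorm_sqr u; rewrite u0 expr0n/= => /esym/eqP.
rewrite psumr_eq0 => [/allP H|i _]; last by rewrite -expr2 sqr_ge0.
apply/rowP => i; have := H i (mem_index_enum _).
by rewrite mxE mulf_eq0 orbb => /eqP.
Qed.

Lemma dot_le u v : dot u v <= enorm u * enorm v.
Proof.
have [u0|u0] := eqVneq (enorm u) 0.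
  by rewrite u0 mul0r (enorm_eq0 u0) -(scale0r 0) dotZl mul0r.
have [v0|v0] := eqVneq (enorm v) 0.
  by rewrite v0 mulr0 (enorm_eq0 v0) -(scale0r 0) dotZr mul0r.
have up : 0 < enorm u by rewrite lt_def u0 enorm_ge0.
have vp : 0 < enorm v by rewrite lt_def v0 enorm_ge0.
have := dotuu_ge0 (enorm v *: u - enorm u *: v).
rewrite !(dotDl, dotDr, dotNl, dotNr, dotZl, dotZr) -!enorm_sqr (dotC v u).
set a := enorm u in up *; set b := enorm v in vp *; set c := dot u v => H.
have : 0 <= 2 * a * b * (a * b - c).
  by apply: le_trans H _; rewrite le_eqVlt; apply/orP; left; apply/eqP; ring.
by rewrite pmulr_rge0 ?subr_ge0// !mulr_gt0.
Qed.

Lemma enormD u v : enorm (u + v) <= enorm u + enorm v.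
Proof.
rewrite -ler_sqr ?nnegrE ?addr_ge0 ?enorm_ge0// enorm_sqr.
rewrite !(dotDl, dotDr) -!enorm_sqr (dotC v u) sqrrD.
have := dot_le u v; lra.
Qed.

Lemma coord_le_enorm u i : `|u ord0 i| <= enorm u.
Proof.
rewrite -ler_sqr ?nnegrE ?enorm_ge0// enorm_sqr real_normK ?num_real//.
rewrite /dot (bigD1 i)//= -expr2 lerDl.
by apply: sumr_ge0 => j _; rewrite -expr2 sqr_ge0.
Qed.

(** Uniform convexity of the Euclidean ball: expanding the square,
    |e u + (1 - e) v|^2 = e |u|^2 + (1 - e) |v|^2 - e (1 - e) |u - v|^2, while
    1 - x^2 <= 2 (1 - x). *)
Lemma enorm_convex e u v : 0 <= e <= 1 -> enorm u <= 1 -> enorm v <= 1 ->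
  e * (1 - e) * enorm (u - v) ^+ 2 <= 2 * (1 - enorm (e *: u + (1 - e) *: v)).
Proof.
move=> /andP[e0 e1] u1 v1; set w := enorm (_ + _ *: v).
have w1 : w <= 1.
  apply: le_trans (enormD _ _) _; rewrite !enormZ ger0_norm// ger0_norm ?subr_ge0//.
  have := ler_wpM2l e0 u1; have e10 : 0 <= 1 - e by lra.
  have := ler_wpM2l e10 v1; lra.
have wE : w ^+ 2 = e * enorm u ^+ 2 + (1 - e) * enorm v ^+ 2 - e * (1 - e) * enorm (u - v) ^+ 2.
  rewrite /w !enorm_sqr !(dotDl, dotDr, dotNl, dotNr, dotZl, dotZr) (dotC v u); ring.
have u2 : enorm u ^+ 2 <= 1 by rewrite expr_le1// enorm_ge0.
have v2 : enorm v ^+ 2 <= 1 by rewrite expr_le1// enorm_ge0.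
have w2 : 1 - w ^+ 2 <= 2 * (1 - w) by nra.
have := ler_wpM2l e0 u2. have := @ler_wpM2l _ (1 - e) _ _ _ v2.
rewrite subr_ge0 => /(_ e1); lra.
Qed.

Lemma measurable_enorm dT (T : measurableType dT) (F : T -> 'rV[R]_d) :
  (forall i, measurable_fun setT (fun x => F x ord0 i)) ->
  measurable_fun setT (fun x => enorm (F x)).
Proof.
move=> mF; apply: (@measurableT_comp _ _ _ _ _ _ (@Num.sqrt R)).
  apply: continuous_measurable_fun; exact: sqrt_continuous.
apply: measurable_sum => i; apply: measurable_funX; exact: mF.
Qed.

End Euclid.

(** * The fundamental theorem of calculus for Lipschitz functions *)
Section FTC.
Context {R : realType}.
Local Notation mu := (@lebesgue_measure R).
Implicit Types (F h k : R -> R) (a b x l : R).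

Lemma ae_mono (P Q : R -> Prop) : (forall x, P x -> Q x) ->
  {ae mu, forall x, P x} -> {ae mu, forall x, Q x}.
Proof. by move=> PQ; apply: filterS; first exact: (ae_filter_ringOfSetsType mu). Qed.

Lemma ae_and (P Q : R -> Prop) : {ae mu, forall x, P x} -> {ae mu, forall x, Q x} ->
  {ae mu, forall x, P x /\ Q x}.
Proof. by apply: filterI; exact: (ae_filter_ringOfSetsType mu). Qed.

Lemma ae_neq (c : R) : {ae mu, forall x : R, x != c}.
Proof.
exists [set c]; split => //; first exact: lebesgue_measure_set1.
by move=> x /= /negP; rewrite negbK => /eqP.
Qed.

Definition dquot F (n : nat) x : R := n.+1%:R * (F (x + n.+1%:R^-1) - F x).

Lemma cvg_dquot F x l : is_derive x 1 F l -> dquot F n x @[n --> \oo] --> l.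
Proof.
move=> [dF <-].
pose q y := y^-1 *: (F (y *: 1 + x) - F x).
have /cvgr_dnbhsP/(_ (fun n => n.+1%:R^-1)) : q y @[y --> 0^'] --> 'D_1 F x by exact: dF.
rewrite (_ : (fun n => q _) = dquot F ^~ x); last first.
  apply/funext => n; rewrite /q /dquot invrK; congr (_ * (F _ - _)).
  by rewrite addrC; congr (_ + _); exact: mulr1.
apply; split; first by move=> n; rewrite invr_eq0.
exact: cvg_harmonic.
Qed.

Definition lipschitz_with (K : R) h := forall x y, `|h x - h y| <= K * `|x - y|.

Lemma lipschitz_continuous K h : lipschitz_with K h -> continuous h.
Proof.
move=> hK x; apply/cvgrPdist_le => e e0.
near=> y; apply: (le_trans (hK _ _)).
apply: (@le_trans _ _ ((`|K| + 1) * `|x - y|)).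
  by rewrite ler_wpM2r//; have := ler_norm K; lra.
rewrite -ler_pdivlMl; last by rewrite ltr_wpDl.
near: y; apply: cvgr_dist_le; first exact: cvg_id.
by rewrite mulr_gt0// invr_gt0 ltr_wpDl.
Unshelve. all: by end_near. Qed.

Lemma dquot_bounded K h n x : lipschitz_with K h -> `|dquot h n x| <= K.
Proof.
move=> hK; rewrite /dquot normrM ger0_norm ?ler0n// -ler_pdivlMl ?ltr0n//.
apply: le_trans (hK _ _) _.
by rewrite addrC addKr ger0_norm ?invr_ge0 ?ler0n// mulrC.
Qed.

Lemma continuous_integrable_itv h a b : continuous h -> mu.-integrable `[a, b] (EFin \o h).
Proof.
move=> ch; apply: continuous_compact_integrable; first exact: segment_compact.
exact: continuous_subspaceT.
Qed.

Lemma measurable_dquot h n : continuous h -> measurable_fun setT (dquot h n).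
Proof.
move=> ch; apply: measurable_funM => //; apply: measurable_funB.
  apply: (@measurableT_comp _ _ _ _ _ _ h); first exact: continuous_measurable_fun.
  exact: measurable_funD.
exact: continuous_measurable_fun.
Qed.

(** The difference quotients are bounded and converge almost everywhere to the
    derivative, while their integrals are differences of difference quotients
    of a primitive of the function: dominated convergence concludes. *)
Lemma lipschitz_FTC K h k a b : a < b -> lipschitz_with K h ->
  measurable_fun setT k -> {ae mu, forall x, is_derive x 1 h (k x)} ->
  mu.-integrable `[a, b] (EFin \o k) /\
  (\int[mu]_(x in `[a, b]) (k x)%:E = (h b - h a)%:E)%E.
Proof.
move=> ab hK mk hk; have ch := lipschitz_continuous hK.
(* Starting at a - 1 makes H differentiable at a as well. *)
pose H x := \int[mu]_(t in `[a - 1, x]) h t.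
have dH x : a <= x -> is_derive x 1 H (h x).
  move=> ax; have [] := @continuous_FTC1 _ h (BLeft (a - 1)) x (x + 1).
  - by rewrite ltrDl.
  - exact: continuous_integrable_itv.
  - by rewrite lte_fin; lra.
  - exact: ch.
  - by move=> dH <-; split; [exact: dH|rewrite derive1E].
have [] := @dominated_convergence _ _ _ mu `[a, b]%classic _
  (fun n x => (dquot h n x)%:E) (EFin \o k) (cst K%:E).
- by [].
- by move=> n; apply/measurable_EFinP/measurable_funTS; exact: measurable_dquot.
- by apply/measurable_EFinP/measurable_funTS.
- apply: ae_mono hk => x hx _; apply: cvg_EFin; last exact: cvg_dquot hx.
  exact: nearW.
- by apply: (@continuous_integrable_itv (cst K)); exact: cst_continuous.
- by apply: aeW => x n _; rewrite lee_fin; exact: dquot_bounded.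
move=> ik _ ck; split => //.
have cH : (dquot H n b - dquot H n a)%:E @[n --> \oo] --> (h b - h a)%:E.
  apply: cvg_EFin; first exact: nearW.
  by apply: cvgB; apply: cvg_dquot; apply: dH => //; exact: ltW.
apply: (cvg_unique _ ck); first exact: ereal_hausdorff.
apply: cvg_trans cH; apply: near_eq_cvg; apply: nearW => n /=.
pose F x := n.+1%:R * (H (x + n.+1%:R^-1) - H x).
have dF x : a <= x -> is_derive x 1 F (dquot h n x).
  move=> ax; have d1 := dH x ax.
  have d2 : is_derive (x + n.+1%:R^-1) 1 H (h (x + n.+1%:R^-1)).
    by apply: dH; rewrite (le_trans ax)// lerDl.
  have d3 : is_derive x 1 (fun x => H (x + n.+1%:R^-1)) (h (x + n.+1%:R^-1)).
    have := @is_derive1_comp R H (fun x => x + n.+1%:R^-1) x _ 1 d2.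
    rewrite mulr1; apply; rewrite -[X in is_derive _ _ _ X]addr0.
    exact: is_deriveD.
  have -> : F = n.+1%:R \*: (fun x => H (x + n.+1%:R^-1) - H x) by [].
  exact: is_deriveZ.
rewrite (@continuous_FTC2 _ (dquot h n) F a b ab).
- rewrite /F /dquot -EFinB; congr (_%:E); ring.
- apply: continuous_subspaceT => x; apply: cvgM; first exact: cvg_cst.
  apply: cvgB; last exact: ch.
  apply: (@cvg_comp _ _ _ (fun x => x + n.+1%:R^-1) h); last exact: ch.
  by apply: cvgD; [exact: cvg_id|exact: cvg_cst].
- have cF x : a <= x -> F @ x --> F x.
    move=> ax; have [d _] := dF x ax.
    exact/differentiable_continuous/derivable1_diffP.
  split.
  + by move=> x; rewrite in_itv/= => /andP[/ltW ax _]; have [] := dF x ax.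
  + by apply: cvg_at_right_filter; exact: cF.
  + by apply: cvg_at_left_filter; apply: cF; exact: ltW.
- move=> x; rewrite in_itv/= => /andP[/ltW ax _].
  by rewrite derive1E; have [_ ->] := dF x ax.
Qed.
End FTC.

(** * Smooth periodic approximations of indicators *)
Section Elementary.
Context {R : realType}.
Implicit Types (f g h : R -> R) (a b x L : R).

(** A class of functions stable under differentiation, rich enough to contain
    the test functions that follow. *)
Inductive elementary : (R -> R) -> Prop :=
| elem_cst c : elementary (fun=> c)
| elem_id : elementary (fun x => x)
| elem_add f g : elementary f -> elementary g -> elementary (fun x => f x + g x)
| elem_mul f g : elementary f -> elementary g -> elementary (fun x => f x * g x)
| elem_sin f : elementary f -> elementary (fun x => sin (f x))
| elem_cos f : elementary f -> elementary (fun x => cos (f x))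
| elem_exp f : elementary f -> elementary (fun x => expR (f x)).

Lemma elementary_is_derive f : elementary f ->
  exists2 g, elementary g & forall x, is_derive x 1 f (g x).
Proof.
elim=> {f} [c| |f g _ [f' ef' df] _ [g' eg' dg]|f g ef [f' ef' df] eg [g' eg' dg]|
            f ef [f' ef' df]|f ef [f' ef' df]|f ef [f' ef' df]].
- exists (fun=> 0) => [|x]; first exact: elem_cst.
  exact: is_derive_cst.
- exists (fun=> 1) => [|x]; first exact: elem_cst.
  exact: is_derive_id.
- exists (fun x => f' x + g' x) => [|x]; first exact: elem_add.
  exact: is_deriveD.
- exists (fun x => f x * g' x + g x * f' x) => [|x].
    by apply: elem_add; apply: elem_mul.
  exact: is_deriveM.
- exists (fun x => cos (f x) * f' x) => [|x].
    by apply: elem_mul => //; apply: elem_cos.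
  exact: is_derive1_comp.
- exists (fun x => - 1 * sin (f x) * f' x) => [|x].
    by apply: elem_mul => //; apply: elem_mul; [exact: elem_cst|exact: elem_sin].
  rewrite mulN1r; exact: is_derive1_comp.
- exists (fun x => expR (f x) * f' x) => [|x].
    by apply: elem_mul => //; apply: elem_exp.
  exact: is_derive1_comp.
Qed.

Lemma elementary_smooth f n : elementary f ->
  elementary (f^`(n)%classic) /\ forall x, derivable (f^`(n)%classic) x 1.
Proof.
move=> ef; elim: n => [|n [IH dfn]].
  by split => // x; have [g _ dg] := elementary_is_derive ef; have [] := dg x.
have [g eg dg] := elementary_is_derive IH.
have -> : f^`(n.+1)%classic = g.
  by apply/funext => x; rewrite derive1nS derive1E; have [_ ->] := dg x.
split => // x; have [k _ dk] := elementary_is_derive eg; have [] := dk x => //.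
Qed.

(** The product of sines is positive exactly on ]a, b[ modulo the period, so
    that the windows built from it, which are smooth, periodic and between 0
    and 1, converge to the indicator of ]a, b[. *)
Definition window_sign L a b x : R := sin (pi / L * (x - a)) * sin (pi / L * (b - x)).

Definition window L a b (n : nat) x : R := expR (- expR (- (n%:R * window_sign L a b x))).

Lemma elementary_window L a b n : elementary (window L a b n).
Proof.
rewrite /window /window_sign.
have el c e : elementary (fun x => pi / L * (c * x + e)).
  apply: elem_mul; first exact: elem_cst.
  apply: elem_add; last exact: elem_cst.
  by apply: elem_mul; [exact: elem_cst|exact: elem_id].
rewrite (_ : (fun x => _) = (fun x => expR (-1 * expR (- n%:R *
  (sin (pi / L * (1 * x + - a)) * sin (pi / L * (-1 * x + b))))))); last first.
  by apply/funext => x; rewrite !mulN1r mul1r mulNr (addrC (- x)).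
apply: elem_exp; apply: elem_mul; first exact: elem_cst.
apply: elem_exp; apply: elem_mul; first exact: elem_cst.
by apply: elem_mul; apply: elem_sin.
Qed.

Lemma window_periodic L a b n : L != 0 -> periodic (window L a b n) L.
Proof.
move=> L0 x; rewrite /window /window_sign.
have -> : pi / L * (x + L - a) = pi / L * (x - a) + pi by field.
have -> : pi / L * (b - (x + L)) = pi / L * (b - x) - pi by field.
have sinBpi y : sin (y - pi) = - sin y by rewrite -[y in RHS](subrK pi) sinDpi opprK.
by rewrite sinDpi sinBpi mulrNN.
Qed.

Lemma window_ge0 L a b n x : 0 <= window L a b n x.
Proof. exact: expR_ge0. Qed.

Lemma window_le1 L a b n x : window L a b n x <= 1.
Proof. by rewrite /window -expR0 ler_expR oppr_le0 expR_ge0. Qed.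

Lemma cvg_expRNn (c : R) : 0 < c -> expR (- (n%:R * c)) @[n --> \oo] --> (0 : R).
Proof.
move=> c0.
rewrite (_ : (fun n => _) = (fun n => expR (- c) ^+ n)); last first.
  by apply/funext => n; rewrite -mulrN expRM_natl.
by apply: cvg_expr; rewrite ger0_norm ?expR_ge0// -expR0 ltr_expR oppr_lt0.
Qed.

Lemma cvg_window L a b x : 0 < L -> 0 <= a -> a < b -> b <= L -> 0 < x < L ->
  x != a -> x != b ->
  window L a b n x @[n --> \oo] --> (\1_(`]a, b[%classic) x : R).
Proof.
move=> L0 a0 ab bL /andP[x0 xL] xa xb.
have piL y : 0 < y < L -> 0 < sin (pi / L * y).
  move=> /andP[y0 yL]; apply: sin_gt0_pi; rewrite mulr_gt0 ?divr_gt0 ?pi_gt0//=.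
  by rewrite -mulrA gtr_pMr ?pi_gt0// mulrC ltr_pdivrMr// mul1r.
have piLN y : - L < y < 0 -> sin (pi / L * y) < 0.
  move=> /andP[yL y0]; rewrite -[y]opprK mulrN sinN oppr_lt0; apply: piL; lra.
have neg : window_sign L a b x < 0 -> window L a b n x @[n --> \oo] --> (0 : R).
  move=> s0; set c := - window_sign L a b x; have c0 : 0 < c by rewrite oppr_gt0.
  apply: (@squeeze_cvgr _ _ _ _ (fun=> 0) (fun n => expR (- (n%:R * c)))).
  - apply: nearW => n; rewrite window_ge0/= /window ler_expR lerN2 -mulrN -/c.
    by apply: le_trans (expR_ge1Dx _); rewrite lerDr.
  - exact: cvg_cst.
  - exact: cvg_expRNn.
have [lxa|gxa] := ltP x a.
  rewrite indicE memNset; last by rewrite /= in_itv/= => /andP[ax _]; lra.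
  by apply: neg; rewrite /window_sign nmulr_rlt0; [apply: piL; lra|apply: piLN; lra].
have {}gxa : a < x by rewrite lt_def xa.
have [gxb|lxb] := ltP b x.
  rewrite indicE memNset; last by rewrite /= in_itv/= => /andP[_ ax]; lra.
  by apply: neg; rewrite /window_sign pmulr_rlt0; [apply: piLN; lra|apply: piL; lra].
have {}lxb : x < b by rewrite lt_def eq_sym xb.
rewrite indicE mem_set; last by rewrite /= in_itv/= gxa.
rewrite -(expR0 R) -oppr0.
apply: (@cvg_comp _ _ _ _ (@expR R)); last exact: continuous_expR.
apply: cvgN; apply: cvg_expRNn.
by rewrite /window_sign mulr_gt0//; apply: piL; lra.
Qed.

End Elementary.

(** * The distance on the circle *)
Section Circle.
Context {R : realType}.
Variables (L : R) (L0 : 0 < L).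
Implicit Types (s t w x : R).

Lemma circ_mod_ge0 x : 0 <= circ_mod L x.
Proof. by rewrite subr_ge0 mulrC -ler_pdivlMr// ge_floor. Qed.

Lemma circ_mod_lt x : circ_mod L x < L.
Proof.
have := floorD1_gt (x / L); rewrite intrD ltr_pdivrMr// /circ_mod; lra.
Qed.

Lemma circ_modDz x (n : int) : circ_mod L (x + n%:~R * L) = circ_mod L x.
Proof.
rewrite /circ_mod mulrDl mulfK ?gt_eqF// floorDrz ?intr_int// rmorphD/= intrKfloor; ring.
Qed.

Lemma circ_mod_small x : 0 <= x < L -> circ_mod L x = x.
Proof.
move=> /andP[x0 xL].
have xL0 : 0 <= x / L by rewrite divr_ge0// ltW.
have xL1 : x / L < 1 by rewrite ltr_pdivrMr// mul1r.
by rewrite /circ_mod (@floor_def _ _ 0) ?mulr0 ?subr0// add0r xL0.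
Qed.

Lemma circ_modD x : circ_mod L (x + L) = circ_mod L x.
Proof. by rewrite -[X in _ + X]mul1r (circ_modDz x 1). Qed.

Lemma circ_mod_periodic (T : Type) (P : R -> T) x :
  (forall x, P (x + L) = P x) -> P (circ_mod L x) = P x.
Proof.
move=> PL; rewrite /circ_mod mulrC -mulNr -mulrNz; exact: periodicMz.
Qed.

Lemma circ_distD s t : circ_dist L s (t + L) = circ_dist L s t.
Proof. by rewrite /circ_dist addrAC circ_modD. Qed.

Lemma circ_dist_shift s w : - (L / 2) < w < L / 2 -> circ_dist L s (s + w) = `|w|.
Proof.
move=> /andP[w1 w2]; rewrite /circ_dist addrC addKr.
have [w0|w0] := leP 0 w.
  by rewrite circ_mod_small ?w0/=; [rewrite min_l ?ger0_norm//|]; lra.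
have -> : circ_mod L w = w + L.
  by rewrite -circ_modD circ_mod_small//; apply/andP; split; lra.
by rewrite min_r ?ltr0_norm//; lra.
Qed.

Lemma circ_dist_ge0 s t : 0 <= circ_dist L s t.
Proof. by rewrite le_min circ_mod_ge0 subr_ge0 ltW// circ_mod_lt. Qed.

Lemma circ_dist_le s t : circ_dist L s t <= `|t - s|.
Proof.
have H0 := circ_mod_ge0 (t - s); have HL := circ_mod_lt (t - s).
have N1 := ler_norm (t - s); have N2 := ler_norm (- (t - s)); rewrite normrN in N2.
rewrite /circ_dist ge_min; apply/orP; have [ts|ts] := leP 0 (t - s).
  left; have [tsL|Lts] := ltP (t - s) L; last lra.
  by rewrite circ_mod_small ?ts.
right; have [tsL|Lts] := leP (- L) (t - s); last lra.
rewrite -circ_modD circ_mod_small; last by apply/andP; split; lra.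
lra.
Qed.

Lemma measurable_circ_dist :
  measurable_fun setT (fun z : R * R => circ_dist L z.1 z.2).
Proof.
have mmod : measurable_fun setT (circ_mod L).
  apply: measurable_funB => //; apply: measurable_funM => //.
  apply: (@measurableT_comp _ _ _ _ _ _ (fun y : R => (Num.floor y)%:~R : R)).
    by apply: nondecreasing_measurable => // x y xy; rewrite ler_int le_floor.
  exact: measurable_funM.
have mz : measurable_fun setT (fun z : R * R => circ_mod L (z.2 - z.1)).
  by apply: measurableT_comp => //; exact: measurable_funB.
by apply: measurable_minr => //; exact: measurable_funB.
Qed.

End Circle.

(** * Curves parametrized by arc-length *)
Section Curve.
Context {R : realType} {d : nat}.
Variables (L : R) (L0 : 0 < L) (f : R -> 'rV[R]_d) (hf : arclength_embedded L f).
Local Notation mu := (@lebesgue_measure R).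
Implicit Types (s t w x : R) (v : 'rV[R]_d).

Definition coordf (i : 'I_d) : R -> R := fun s => f s ord0 i.

(** The upper limit of the difference quotients makes this representative of the
    derivative total, Borel measurable and periodic. *)
Definition velocity s : 'rV[R]_d := \row_i limn_sup (fun n => dquot (coordf i) n s).

Lemma curve_lip : exists K, forall s t, enorm (f s - f t) <= K * `|s - t|.
Proof.
have [K HK] := curve_lipschitz hf; exists `|K| => s t.
apply: le_trans (HK _ _) _; apply: le_trans (ler_wpM2r (circ_dist_ge0 L0 _ _) (ler_norm K)) _.
by rewrite ler_wpM2l// circ_dist_le.
Qed.

Lemma curve_dot_lip v : exists K, lipschitz_with K (fun s => dot v (f s)).
Proof.
have [K HK] := curve_lip; exists (enorm v * K) => s t.
have -> : dot v (f s) - dot v (f t) = dot v (f s - f t) by rewrite dotDr dotNr.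
have H u : dot v u <= enorm v * enorm u by exact: dot_le.
have : `|dot v (f s - f t)| <= enorm v * enorm (f s - f t).
  rewrite ler_norml; apply/andP; split; last exact: dot_le.
  by rewrite lerNl -dotNr -[enorm (f s - _)]enormN dot_le.
by move=> /le_trans; apply; rewrite -mulrA ler_wpM2l ?enorm_ge0.
Qed.

Lemma coordf_lip i : exists K, lipschitz_with K (coordf i).
Proof.
have [K HK] := curve_lip; exists K => s t; apply: le_trans (HK s t).
have -> : coordf i s - coordf i t = (f s - f t) ord0 i by rewrite !mxE.
exact: coord_le_enorm.
Qed.

Lemma coordf_continuous i : continuous (coordf i).
Proof. by have [K HK] := coordf_lip i; exact: lipschitz_continuous HK. Qed.

Lemma coordf_measurable i : measurable_fun setT (coordf i).
Proof. by apply: continuous_measurable_fun; exact: coordf_continuous. Qed.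

Lemma velocity_measurable i : measurable_fun setT (fun s => velocity s ord0 i).
Proof.
have [K HK] := coordf_lip i.
rewrite (_ : (fun s => _) = (fun s => limn_sup (fun n => dquot (coordf i) n s))); last first.
  by apply/funext => s; rewrite mxE.
apply: measurable_fun_limn_sup => [s _|s _|n].
- exists K => _ [n _ <-]; exact: le_trans (ler_norm _) (dquot_bounded _ _ HK).
- exists (- K) => _ [n _ <-]; have := dquot_bounded n s HK.
  by rewrite ler_norml => /andP[].
- by apply: measurable_dquot; exact: coordf_continuous.
Qed.

Lemma velocity_periodic : periodic velocity L.
Proof.
move=> s; apply/rowP => i; rewrite !mxE; congr limn_sup; apply/funext => n.
by rewrite /dquot /coordf addrAC !(curve_periodic hf).
Qed.

Lemma coordf_derive s i : derivable f s 1 ->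
  is_derive s 1 (coordf i) (f^`()%classic s ord0 i).
Proof.
move=> df; split; first by have /derivable_mxP := df; apply.
by rewrite derive1E (derive_mx df) mxE.
Qed.

Lemma velocityE s : derivable f s 1 -> velocity s = f^`()%classic s.
Proof.
move=> df; apply/rowP => i; rewrite mxE.
by have [_ ->] := cvg_limn_inf_sup (cvg_dquot (coordf_derive i df)).
Qed.

Lemma velocity_ae : {ae mu, forall s,
  [/\ velocity s = f^`()%classic s, enorm (velocity s) = 1 &
      forall i, is_derive s 1 (coordf i) (velocity s ord0 i)]}.
Proof.
apply: ae_mono (curve_unit_speed hf) => s [df f1].
rewrite velocityE//; split => // i; exact: coordf_derive.
Qed.

Lemma dot_coordf v : (fun s => dot v (f s)) = \sum_(i < d) (v ord0 i *: coordf i).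
Proof.
apply/funext => s; rewrite fct_sumE; apply: eq_bigr => i _.
by [].
Qed.

Lemma dot_derive v s (l : 'rV[R]_d) : (forall i, is_derive s 1 (coordf i) (l ord0 i)) ->
  is_derive s 1 (fun s => dot v (f s)) (dot v l).
Proof.
move=> dfi; rewrite dot_coordf /dot; by apply: is_derive_sum.
Qed.

Lemma measurable_dot v (g : R -> 'rV[R]_d) : (forall i, measurable_fun setT (fun s => g s ord0 i)) ->
  measurable_fun setT (fun s => dot v (g s)).
Proof. by move=> mg; apply: measurable_sum => i; exact: measurable_funM. Qed.

Lemma lipschitz_monotone (K a b : R) (h k : R -> R) : a <= b -> lipschitz_with K h ->
  measurable_fun setT k -> {ae mu, forall x, is_derive x 1 h (k x) /\ 0 <= k x} ->
  h a <= h b.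
Proof.
rewrite le_eqVlt => /predU1P[->//|ab] hK mk hk.
have [_ hE] := lipschitz_FTC ab hK mk (ae_mono (fun x => @proj1 _ _) hk).
rewrite -subr_ge0 -lee_fin -hE.
rewrite (@ae_eq_integral _ _ _ mu `[a, b]%classic (fun x => (Num.max 0 (k x))%:E)) //.
- by apply: integral_ge0 => x _; rewrite lee_fin le_max lexx.
- by apply/measurable_EFinP/measurable_funTS.
- by apply/measurable_EFinP/measurable_funTS; exact: measurable_maxr.
- by apply: ae_mono hk => x [_ k0] _; rewrite max_r.
Qed.

(** Compare the displacement with the projection of the curve onto the direction
    of the displacement, which moves at speed at most 1. *)
Lemma curve_lip1 s t : enorm (f t - f s) <= `|t - s|.
Proof.
wlog st : s t / s <= t.
  move=> H; have [|/ltW ts] := leP s t; first exact: H.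
  by rewrite enormB distrC H.
set v := f t - f s.
have [v0|v0] := eqVneq (enorm v) 0; first by rewrite v0.
have vp : 0 < enorm v by rewrite lt_def v0 enorm_ge0.
have [K HK] := curve_dot_lip v.
(* Nondecreasing, since the projection on v moves at speed at most |v|. *)
pose h x := enorm v * x - dot v (f x).
have hK : lipschitz_with (enorm v + K) h.
  move=> x y; rewrite mulrDl.
  have -> : h x - h y = enorm v * (x - y) - (dot v (f x) - dot v (f y)) by rewrite /h; ring.
  apply: le_trans (ler_normB _ _) _; apply: lerD; last exact: HK.
  by rewrite normrM ger0_norm// enorm_ge0.
have : h s <= h t.
  apply: (lipschitz_monotone (k := fun x => enorm v - dot v (velocity x)) st hK).
    by apply: measurable_funB => //; apply: measurable_dot; exact: velocity_measurable.
  apply: ae_mono velocity_ae => x [_ v1 dv]; split.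
    apply: is_deriveB; last exact: dot_derive.
    rewrite -[X in is_derive _ _ _ X]mulr1; exact: is_deriveZ.
  by rewrite subr_ge0; apply: le_trans (dot_le _ _) _; rewrite v1 mulr1.
rewrite /h => H; have : dot v (f t) - dot v (f s) <= enorm v * (t - s) by lra.
rewrite -dotNr -dotDr -/v -enorm_sqr expr2 ler_pM2l// => H'.
by rewrite ger0_norm// subr_ge0.
Qed.

Lemma arc_lengthE (a b : R) : a <= b -> arc_length f a b = (b - a)%:E.
Proof.
move=> ab; rewrite /arc_length (@ge0_ae_eq_integral_nomeas _ _ _ mu `[a, b]%classic _ (cst 1%E))//.
- rewrite integral_cst//= mul1e lebesgue_measure_itv/= lte_fin.
  case: ltP => [_|ba]; first by rewrite EFinB.
  by have -> : b - a = 0 by lra.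
- by move=> x _; rewrite lee_fin enorm_ge0.
- by apply: ae_mono (curve_unit_speed hf) => x [_ ->].
Qed.

(** At unit speed, the two arcs joining the points of parameters s and t have
    lengths r and L - r, where r is the representative of t - s modulo L. *)
Lemma intrinsic_distE s t : intrinsic_dist L f s t = circ_dist L s t.
Proof.
have r0 := circ_mod_ge0 L0 (t - s); have rL := circ_mod_lt L0 (t - s).
rewrite /intrinsic_dist !arc_lengthE ?lerDl ?lerD2l//; last exact: ltW.
rewrite addrAC subrr add0r -EFin_min/=; congr Num.min; lra.
Qed.

(** For 0 < |w| < L, the parameters s and s + w differ modulo L, so that
    injectivity separates the points. *)
Lemma curve_separated s w : 0 < `|w| < L -> 0 < enorm (f (s + w) - f s).
Proof.
move=> /andP[w0 wL]; rewrite lt_def enorm_ge0 andbT; apply/negP => /eqP/enorm_eq0/eqP.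
rewrite subr_eq0 => /eqP fE.
have : circ_mod L (s + w) = circ_mod L s.
  have in0L x : circ_mod L x \in `[0, L[ by rewrite in_itv/= circ_mod_ge0// circ_mod_lt.
  apply: (curve_injective hf) => //.
  by rewrite !(circ_mod_periodic _ (curve_periodic hf)).
rewrite /circ_mod; set m := Num.floor _; set n := Num.floor _ => E.
have wE : w = L * (m - n)%:~R by rewrite intrB; lra.
move: w0 wL; rewrite wE normrM gtr0_norm// gtr_pMr// pmulr_rgt0// -intr_norm.
rewrite ltr0z -[1]/(1%:~R) ltr_int gtz0_ge1 => /le_lt_trans /[apply].
by rewrite ltxx.
Qed.

End Curve.

(** * Bounds on 1 / Phi from its logarithmic slope *)
Section Phi.
Context {R : realType}.
Variable Phi : R -> R.
Hypothesis Phi_ge0 : forall x : R, 0 <= x -> 0 <= Phi x.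
Hypothesis Phi_C1 : forall x : R, 0 < x ->
     derivable Phi x 1 /\ {for x, continuous (Phi^`()%classic)}.
Hypothesis Phi_incr : forall x : R, 0 < x -> 0 < Phi^`()%classic x.
Implicit Types x y r : R.

Lemma Phi_derive x : 0 < x -> is_derive x 1 Phi (Phi^`()%classic x).
Proof. by move=> /Phi_C1[d _]; split => //; rewrite derive1E. Qed.

Lemma Phi_continuous x : 0 < x -> {for x, continuous Phi}.
Proof. by move=> /Phi_C1[d _]; exact/differentiable_continuous/derivable1_diffP. Qed.

Lemma Phi_lt x y : 0 < x -> x < y -> Phi x < Phi y.
Proof.
move=> x0 xy.
have [c||c] := @MVT _ Phi (Phi^`()%classic) x y xy.
- by rewrite in_itv/= => /andP[xc _]; apply: Phi_derive; exact: lt_trans xc.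
- apply: continuous_in_subspaceT => c; rewrite inE/= in_itv/= => /andP[xc _].
  by apply: Phi_continuous; exact: lt_le_trans xc.
- rewrite in_itv/= => /andP[xc _] E; rewrite -subr_gt0 E mulr_gt0 ?subr_gt0//.
  by apply: Phi_incr; exact: lt_trans xc.
Qed.

Lemma Phi_gt0 x : 0 < x -> 0 < Phi x.
Proof.
move=> x0; have x20 : 0 < x / 2 by lra.
apply: le_lt_trans (Phi_ge0 (ltW x20)) _; apply: Phi_lt; lra.
Qed.

Lemma Phi_le x y : 0 < x -> x <= y -> Phi x <= Phi y.
Proof. by move=> x0; rewrite le_eqVlt => /predU1P[->//|/(Phi_lt x0)/ltW]. Qed.

(** The derivative of log Phi with respect to log x. *)
Definition log_slope x := x * Phi^`()%classic x / Phi x.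

Lemma log_slope_gt0 x : 0 < x -> 0 < log_slope x.
Proof. by move=> x0; rewrite divr_gt0 ?mulr_gt0 ?Phi_incr ?Phi_gt0. Qed.

Lemma log_slope_continuous x : 0 < x -> {for x, continuous log_slope}.
Proof.
move=> x0; apply: cvgM.
  by apply: cvgM; [exact: cvg_id|have [] := Phi_C1 x0].
by apply: cvgV; [rewrite gt_eqF// Phi_gt0|exact: Phi_continuous].
Qed.

(** Close to 0 the limit of the slope bounds it on both sides; on the remaining
    compact interval, it is continuous and positive. *)
Lemma log_slope_bounds r :
  (exists K : R, 0 < K /\ log_slope x @[x --> 0^'+] --> K) -> 0 < r ->
  exists m M : R, [/\ 0 < m, 0 < M & forall x, 0 < x <= r -> m <= log_slope x <= M].
Proof.
move=> [K [K0 cK]] r0.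
have K20 : 0 < K / 2 by lra.
have /cvgrPdist_le/(_ _ K20) [e /= e0 He] := cK.
pose b := Num.min (e / 2) r.
have b0 : 0 < b by rewrite lt_min r0 andbT; lra.
have br : b <= r by rewrite ge_min lexx orbT.
have be : b < e by rewrite gt_min; apply/orP; left; lra.
have cont : {within `[b, r], continuous log_slope}.
  apply: continuous_in_subspaceT => x; rewrite inE/= in_itv/= => /andP[bx _].
  by apply: log_slope_continuous; exact: lt_le_trans bx.
have [c1 c1b H1] := EVT_max br cont.
have [c2 c2b H2] := EVT_min br cont.
have c20 : 0 < log_slope c2.
  by apply: log_slope_gt0; move: c2b; rewrite in_itv/= => /andP[bx _]; exact: lt_le_trans bx.
exists (Num.min (K / 2) (log_slope c2)), (Num.max (2 * K) (log_slope c1)); split.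
- by rewrite lt_min K20.
- by rewrite lt_max; apply/orP; left; lra.
- move=> x /andP[x0 xr]; rewrite ge_min le_max.
  have [bx|xb] := leP b x.
    by rewrite H1 ?H2 ?orbT// in_itv/= bx.
  have : `|K - log_slope x| <= K / 2.
    apply: He => //=; rewrite sub0r normrN gtr0_norm//; exact: lt_trans be.
  rewrite ler_norml => /andP[h1 h2].
  by apply/andP; split; apply/orP; left; lra.
Qed.

(** The mean value theorem for 1 / Phi, whose derivative at c is
    - log_slope c / (c Phi(c)). *)
Lemma inv_Phi_diff x y : 0 < x -> x < y -> exists c,
  x < c < y /\ (Phi x)^-1 - (Phi y)^-1 = log_slope c / (c * Phi c) * (y - x).
Proof.
move=> x0 xy.
have dV (c : R) : 0 < c -> is_derive c 1 (fun t : R => (Phi t)^-1) (- (Phi c) ^- 2 *: Phi^`()%classic c).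
  move=> c0; have dc := Phi_derive c0; apply: is_deriveV.
  by rewrite gt_eqF// Phi_gt0.
have [c||c] := @MVT _ (fun t : R => (Phi t)^-1) (fun c : R => - (Phi c) ^- 2 *: Phi^`()%classic c) x y xy.
- by rewrite in_itv/= => /andP[xc _]; apply: dV; exact: lt_trans xc.
- apply: continuous_in_subspaceT => c; rewrite inE/= in_itv/= => /andP[xc _].
  have c0 := lt_le_trans x0 xc.
  by apply: cvgV; [rewrite gt_eqF// Phi_gt0|exact: Phi_continuous].
- rewrite in_itv/= => xcy E; exists c; split => //.
  have c0 : 0 < c by move: xcy => /andP[/(lt_trans x0)].
  rewrite -opprB E /log_slope /GRing.scale/=; field.
  by rewrite !gt_eqF// Phi_gt0.
Qed.

(** The mean value theorem, with c Phi(c) <= y Phi(y) since Phi increases. *)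
Lemma inv_Phi_ge m x y : 0 < x -> x <= y ->
  (forall c, 0 < c <= y -> m <= log_slope c) -> 0 <= m ->
  m * (1 - x / y) / Phi y <= (Phi x)^-1 - (Phi y)^-1.
Proof.
move=> x0; rewrite le_eqVlt => /predU1P[<- _ _|xy Hm m0].
  by rewrite divff ?gt_eqF// !subrr mulr0 mul0r.
have [c [/andP[xc cy] ->]] := inv_Phi_diff x0 xy.
have c0 := lt_trans x0 xc; have y0 := lt_trans x0 xy.
have -> : m * (1 - x / y) / Phi y = m / (y * Phi y) * (y - x).
  by field; rewrite !gt_eqF// Phi_gt0.
rewrite ler_wpM2r ?subr_ge0 ?(ltW xy)// ler_pM ?invr_ge0 ?mulr_ge0 ?Phi_ge0 ?(ltW y0)//.
  by apply: Hm; rewrite c0 ltW.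
rewrite lef_pV2 ?posrE ?mulr_gt0 ?Phi_gt0// ler_pM ?Phi_ge0 ?(ltW c0) ?(ltW cy)//.
by apply: Phi_le => //; exact: ltW.
Qed.

(** The mean value theorem, with x Phi(x) <= c Phi(c) since Phi increases. *)
Lemma inv_Phi_le M x y : 0 < x -> x <= y ->
  (forall c, 0 < c <= y -> log_slope c <= M) ->
  (Phi x)^-1 - (Phi y)^-1 <= M * (y - x) / (x * Phi x).
Proof.
move=> x0; rewrite le_eqVlt => /predU1P[<- _|xy HM].
  by rewrite !subrr mulr0 mul0r.
have [c [/andP[xc cy] ->]] := inv_Phi_diff x0 xy.
have c0 := lt_trans x0 xc; have y0 := lt_trans x0 xy.
rewrite [leRHS]mulrAC ler_wpM2r ?subr_ge0 ?(ltW xy)// ler_pM ?invr_ge0 ?mulr_ge0 ?Phi_ge0 ?(ltW c0)//.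
- exact/ltW/Phi_incr.
- by rewrite invr_ge0 Phi_ge0 ?ltW.
- by apply: HM; rewrite c0 ltW.
rewrite lef_pV2 ?posrE ?mulr_gt0 ?Phi_gt0// ler_pM ?Phi_ge0 ?(ltW x0) ?(ltW xc)//.
by apply: Phi_le => //; exact: ltW.
Qed.

End Phi.

(** * Lower limits, Fatou's lemma and a small scaling ratio *)
Section Liminf.
Context {R : realType}.
Local Open Scope ereal_scope.

Lemma limn_einf_le (u : (\bar R)^nat) B : (forall n, u n <= B) -> limn_einf u <= B.
Proof.
move=> uB; rewrite limn_einf_lim; apply: lime_le; first exact: is_cvg_einfs.
apply: nearW => n; apply: le_trans (uB n); apply: ereal_inf_lbound => /=.
by exists n => /=.
Qed.

Lemma limn_einf_ge (u : (\bar R)^nat) B : (forall n, B <= u n) -> B <= limn_einf u.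
Proof.
move=> uB; rewrite limn_einf_lim; apply: lime_ge; first exact: is_cvg_einfs.
by apply: nearW => n; apply: le_ereal_inf_tmp => _ [m _ <-].
Qed.

Lemma powR_le_limn_einf (u : R^nat) (l r : R) : (0 < r)%R -> (forall n, 0 <= u n)%R ->
  u @ \oo --> l -> (l `^ r)%:E <= limn_einf (fun n => (u n `^ r)%:E).
Proof.
move=> r0 u0 ul.
have l0 : (0 <= l)%R.
  rewrite -(cvg_lim _ ul)//; apply: limr_ge; first by apply/cvg_ex; exists l.
  exact: nearW.
move: l0; rewrite le_eqVlt => /predU1P[<-|lp].
  by rewrite powR0 ?gt_eqF//; apply: limn_einf_ge => n; rewrite lee_fin powR_ge0.
have cp : (u n `^ r)%R @[n --> \oo] --> (l `^ r)%R.
  have dl : derivable ((@powR R)^~ r) l 1 by apply: derivable_powR; rewrite in_itv/= lp.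
  have cl : {for l, continuous ((@powR R)^~ r)}.
    exact/differentiable_continuous/derivable1_diffP.
  by apply: (@cvg_comp _ _ _ u ((@powR R)^~ r)); first exact: ul.
have /cvg_limn_einf_sup[-> _] : (u n `^ r)%:E @[n --> \oo] --> (l `^ r)%:E.
  by apply: cvg_EFin => //; exact: nearW.
by [].
Qed.

(** The power is lower semicontinuous; when the weight c vanishes, both sides
    do, and the sequence need not converge. *)
Lemma weighted_powR_le_limn_einf (c q l : R) (u : R^nat) : (0 <= c)%R -> (0 < q)%R ->
  (forall n, 0 <= u n)%R -> (0 <= l)%R -> (c != 0%R -> u @ \oo --> l) ->
  (c * l `^ q)%:E <= limn_einf (fun n => (c * u n `^ q)%:E).
Proof.
move=> c0 q0 u0 l0 ul; have [cz|cN0] := eqVneq c 0%R.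
  by rewrite cz mul0r; apply: limn_einf_ge => n; rewrite mul0r.
have cE x : (0 <= x)%R -> (c * x `^ q = (c `^ q^-1 * x) `^ q)%R.
  by move=> x0; rewrite powRM ?powR_ge0// -powRrM mulVf ?gt_eqF// powRr1.
rewrite cE//; under [X in _ <= limn_einf X]eq_fun do rewrite cE//.
apply: powR_le_limn_einf => //; first by move=> n; rewrite mulr_ge0// powR_ge0.
by apply: cvgM; [exact: cvg_cst|exact: ul].
Qed.

Lemma measurable_limn_einf d (T : measurableType d) (f : (T -> \bar R)^nat) :
  (forall n, measurable_fun setT (f n)) -> measurable_fun setT (fun x => limn_einf (f^~ x)).
Proof.
move=> mf; rewrite (_ : (fun x => _) = (fun x => - limn_esup ((fun n => \- f n)^~ x))).
  apply: (@measurableT_comp _ _ _ _ _ _ (@oppe R)); first exact: oppe_measurable.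
  apply: measurable_fun_limn_esup => n.
  by apply: (@measurableT_comp _ _ _ _ _ _ (@oppe R)); first exact: oppe_measurable.
by apply/funext.
Qed.

Lemma fatou_ae d (T : measurableType d) (mu : {measure set T -> \bar R}) (D : set T)
  (f : (T -> \bar R)^nat) (g : T -> \bar R) : measurable D ->
  (forall n, measurable_fun setT (f n)) -> (forall n x, 0 <= f n x) ->
  measurable_fun setT g -> (forall x, 0 <= g x) ->
  {ae mu, forall x, D x -> g x <= limn_einf (f^~ x)} ->
  \int[mu]_(x in D) g x <= limn_einf (fun n => \int[mu]_(x in D) f n x).
Proof.
move=> mD mf f0 mg g0 gf.
apply: (@le_trans _ _ (\int[mu]_(x in D) limn_einf (f^~ x))).
  apply: ae_ge0_le_integral => //.
  - exact: measurable_funTS.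
  - by move=> x _; exact: limn_einf_ge.
  - by apply: measurable_funTS; exact: measurable_limn_einf.
by apply: (fatou mu mD) => // n; exact: measurable_funTS.
Qed.

End Liminf.

Section EnormLimit.
Context {R : realType} {d : nat}.

Lemma cvg_rsum (u : 'I_d -> R^nat) (l : 'I_d -> R) :
  (forall i, u i n @[n --> \oo] --> l i) ->
  (\sum_(i < d) u i n) @[n --> \oo] --> \sum_(i < d) l i.
Proof.
move=> ul; rewrite (_ : (fun n => _) = \sum_(i < d) u i); last first.
  by apply/funext => n; rewrite fct_sumE.
elim/big_ind2 : _ => [|x1 x2 y1 y2 H1 H2|i _]; last exact: ul.
- exact: cvg_cst.
- exact: cvgD.
Qed.

Lemma cvg_enorm (u : nat -> 'rV[R]_d) (l : 'rV[R]_d) :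
  (forall i, u n ord0 i @[n --> \oo] --> l ord0 i) ->
  enorm (u n) @[n --> \oo] --> enorm l.
Proof.
move=> ul; have c : (\sum_i u n ord0 i ^+ 2) @[n --> \oo] --> \sum_i l ord0 i ^+ 2.
  apply: (cvg_rsum (u := fun i n => u n ord0 i ^+ 2) (l := fun i => l ord0 i ^+ 2)) => i.
  by apply: (@cvgM _ _ _ _ (fun n => u n ord0 i) (fun n => u n ord0 i)).
exact: (cvg_comp _ _ c (@sqrt_continuous R _)).
Qed.
End EnormLimit.

Section SmallRatio.
Context {R : realType}.
Local Notation mu := (@lebesgue_measure R).

(** The average of phi^p / t over ]0, e] vanishes as e tends to 0, so that
    phi(t)^p / t is small for some small t. *)
Lemma small_ratio (phi : R -> R) (p eta : R) :
  (forall a : R, 0 < a -> (Mint phi p a < +oo)%E) ->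
  (fun e : R => fine (Mint phi p e)) =o_ (0^'+) (fun e : R => e) ->
  0 < eta -> exists e, 0 < e < 1 /\ phi e `^ p / e <= eta.
Proof.
move=> Mfin /eqoP oM eta0; have eta20 : 0 < eta / 2 by lra.
have [e [e0 e1 He]] : exists e, [/\ 0 < e, e < 1 & `|fine (Mint phi p e)| <= eta / 2 * `|e|].
  have H1 := oM _ eta20.
  near (0 : R)^'+ => e; exists e; split; near: e.
  - exact: nbhs_right_gt.
  - exact: nbhs_right_lt.
  - exact: H1.
(* Otherwise phi(t)^p / t > eta on ]0, e], against M(e) <= eta e / 2. *)
apply: contrapT => /forallNP H.
have He' t : 0 < t <= e -> eta < phi t `^ p / t.
  move=> /andP[t0 te]; rewrite ltNge; apply/negP => tE; apply: (H t).
  by split => //; rewrite t0 (le_lt_trans te).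
have : ((eta * e)%:E <= Mint phi p e)%E.
  have -> : ((eta * e)%:E = \int[mu]_(t in `]0%R, e]) (cst eta%:E) t)%E.
    by rewrite integral_cst//= lebesgue_measure_itv/= lte_fin e0 oppr0 adde0.
  apply: ge0_le_integral_nomeas => t; rewrite /= in_itv/= => te; rewrite lee_fin ltW//.
  exact: He'.
have M0 : (0 <= Mint phi p e)%E.
  apply: integral_ge0 => t; rewrite /= in_itv/= => /andP[t0 _].
  by rewrite lee_fin divr_ge0 ?powR_ge0// ltW.
rewrite -(@fineK _ (Mint phi p e)); last by rewrite ge0_fin_numE// Mfin.
rewrite lee_fin => H2; move: He; rewrite !ger0_norm ?fine_ge0 ?(ltW e0)// => H3.
have : 0 < eta * e by rewrite mulr_gt0.
lra.
Unshelve. all: by end_near. Qed.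
End SmallRatio.

(** * Weighted integrals over pairs of points of the circle *)
Section Weighted.
Context {R : realType}.
Variables (L p : R) (Phi : R -> R).
Hypotheses (L0 : 0 < L) (p1 : 1 <= p).
Hypothesis Phi_ge0 : forall x : R, 0 <= x -> 0 <= Phi x.
Hypothesis Phi_meas : measurable_fun (`[0, +oo[ : set R) Phi.
Hypothesis Phi_0 : Phi 0 = 0.
Hypothesis Phi_gt0 : forall x, 0 < x -> 0 < Phi x.
Local Notation mu := (@lebesgue_measure R).
Implicit Types (s t w k : R) (F G : R -> R -> R).

Definition jointly_measurable F := measurable_fun setT (fun z : R * R => F z.1 z.2).

(** Since Psi(x)^(2p) x = Phi(x)^p, this is the weight of the seminorm of
    W^{Psi,2p}. *)
Definition weight w : R := (Phi `|w| `^ p)^-1.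

(** The energy and the seminorms are compared through integrals of this form, in
    which w is the increment of the parameter: the weight depends on w only,
    and the inner integral is invariant under translations in s. *)
Definition wint F : \bar R :=
  (\int[mu]_(w in `](- (L / 2))%R, (L / 2)%R[)
     ((weight w)%:E * \int[mu]_(s in `[0%R, L[) (F s w)%:E))%E.

Lemma weight_ge0 w : 0 <= weight w.
Proof. by rewrite invr_ge0 powR_ge0. Qed.

Lemma weightN w : weight (- w) = weight w.
Proof. by rewrite /weight normrN. Qed.

Lemma measurable_Phi_abs d (T : measurableType d) (h : T -> R) :
  measurable_fun setT h -> measurable_fun setT (fun x => Phi `|h x|).
Proof.
move=> mh; have mah : measurable_fun setT (fun x => `|h x|) by exact: measurableT_comp.
apply: (measurable_comp _ _ Phi_meas mah) => //.
by move=> _ [x _ <-]; rewrite /= in_itv/= andbT.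
Qed.

Lemma measurable_inv d (T : measurableType d) (h : T -> R) :
  measurable_fun setT h -> measurable_fun setT (fun x => (h x)^-1).
Proof.
move=> mh; rewrite (_ : (fun x => _) = (fun x => h x * `|h x| `^ (- 2))).
  apply: measurable_funM => //; apply: (measurableT_comp (measurable_powR (- 2))).
  exact: measurableT_comp.
apply/funext => x; have [->|x0] := eqVneq (h x) 0; first by rewrite mul0r invr0.
by rewrite powRN powR_mulrn// real_normK ?num_real// expr2; field.
Qed.

Lemma measurable_weight : measurable_fun setT weight.
Proof.
apply: measurable_inv; apply: (measurableT_comp (measurable_powR p)).
exact: measurable_Phi_abs.
Qed.

Lemma jointly_measurable_comp F (a b : R * R -> R) : jointly_measurable F ->
  measurable_fun setT a -> measurable_fun setT b ->
  measurable_fun setT (fun z => F (a z) (b z)).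
Proof.
move=> mF ma mb; apply: (measurableT_comp mF (f := fun z => F z.1 z.2) (g := fun z => (a z, b z))).
exact: measurable_fun_pair.
Qed.

Lemma measurable_slice F : jointly_measurable F -> (forall s w, 0 <= F s w) ->
  measurable_fun setT (fun w => \int[mu]_(s in `[0%R, L[) (F s w)%:E)%E.
Proof.
move=> mF F0.
apply: (@measurable_integral_section _ _ _ _ R mu _ (fun z : R * R => (F z.2 z.1)%:E)) => //.
  by apply/measurable_EFinP; apply: jointly_measurable_comp.
by move=> z; rewrite lee_fin.
Qed.

Lemma measurable_sliceF F w : jointly_measurable F -> measurable_fun setT (fun s => F s w).
Proof. by move=> mF; exact: (measurable_fun_pair1 w mF). Qed.

Lemma slice_ge0 F w : (forall s w, 0 <= F s w) -> (0 <= \int[mu]_(s in `[0%R, L[) (F s w)%:E)%E.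
Proof. by move=> F0; apply: integral_ge0 => s _; rewrite lee_fin. Qed.

Lemma wint_ge0 F : (forall s w, 0 <= F s w) -> (0 <= wint F)%E.
Proof.
by move=> F0; apply: integral_ge0 => w _; rewrite mule_ge0 ?lee_fin ?weight_ge0// slice_ge0.
Qed.

Lemma wintE F : jointly_measurable F -> (forall s w, 0 <= F s w) ->
  wint F = (\int[mu]_(w in `](- (L / 2))%R, (L / 2)%R[)
    \int[mu]_(s in `[0%R, L[) (weight w * F s w)%:E)%E.
Proof.
move=> mF F0; apply: eq_integral => w _; under [RHS]eq_integral do rewrite EFinM.
rewrite ge0_integralZl_EFin ?weight_ge0//.
- by move=> s _; rewrite lee_fin.
- by apply/measurable_EFinP/measurable_funTS; exact: measurable_sliceF.
Qed.

Lemma wint_le F G : (forall s w, 0 <= F s w) -> (forall s w, F s w <= G s w) ->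
  (wint F <= wint G)%E.
Proof.
move=> F0 FG; apply: ge0_le_integral_nomeas => w _.
  by rewrite mule_ge0 ?lee_fin ?weight_ge0// slice_ge0.
rewrite lee_wpmul2l ?lee_fin ?weight_ge0//.
by apply: ge0_le_integral_nomeas => s _; rewrite lee_fin.
Qed.

Lemma measurable_weight_slice F : jointly_measurable F -> (forall s w, 0 <= F s w) ->
  measurable_fun setT (fun w => ((weight w)%:E * \int[mu]_(s in `[0%R, L[) (F s w)%:E)%E).
Proof.
move=> mF F0; apply: emeasurable_funM; last exact: measurable_slice.
by apply/measurable_EFinP; exact: measurable_weight.
Qed.

Lemma wintD F G : jointly_measurable F -> jointly_measurable G ->
  (forall s w, 0 <= F s w) -> (forall s w, 0 <= G s w) ->
  wint (fun s w => F s w + G s w) = (wint F + wint G)%E.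
Proof.
move=> mF mG F0 G0; rewrite /wint -ge0_integralD//; last 4 first.
- by move=> w _; rewrite mule_ge0 ?lee_fin ?weight_ge0// slice_ge0.
- by apply: measurable_funTS; exact: measurable_weight_slice.
- by move=> w _; rewrite mule_ge0 ?lee_fin ?weight_ge0// slice_ge0.
- by apply: measurable_funTS; exact: measurable_weight_slice.
apply: eq_integral => w _; rewrite -ge0_muleDr ?slice_ge0//; congr (_ * _)%E.
rewrite -ge0_integralD//.
- by move=> s _; rewrite lee_fin.
- by apply/measurable_EFinP/measurable_funTS; exact: measurable_sliceF.
- by move=> s _; rewrite lee_fin.
- by apply/measurable_EFinP/measurable_funTS; exact: measurable_sliceF.
Qed.

Lemma wintZ c F : 0 <= c -> jointly_measurable F -> (forall s w, 0 <= F s w) ->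
  wint (fun s w => c * F s w) = (c%:E * wint F)%E.
Proof.
move=> c0 mF F0; rewrite /wint -ge0_integralZl_EFin//; last 2 first.
- by move=> w _; rewrite mule_ge0 ?lee_fin ?weight_ge0// slice_ge0.
- by apply: measurable_funTS; exact: measurable_weight_slice.
apply: eq_integral => w _; rewrite muleCA; congr (_ * _)%E.
rewrite -ge0_integralZl_EFin//.
- by move=> s _; rewrite lee_fin.
- by apply/measurable_EFinP/measurable_funTS; exact: measurable_sliceF.
Qed.

Lemma weight_scale (phi : R -> R) k w : 0 < k -> 0 <= phi k ->
  (forall x, 0 <= x -> Phi (k * x) <= phi k * Phi x) ->
  weight w <= phi k `^ p * weight (k * w).
Proof.
move=> k0 phik0 H; have [->|w0] := eqVneq w 0.
  rewrite mulr0 /weight normr0 Phi_0 powR0 ?invr0 ?mulr0//.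
  by rewrite gt_eqF//; exact: lt_le_trans p1.
have w0' : 0 < `|w| by rewrite normr_gt0.
rewrite /weight normrM gtr0_norm//; have := H _ (ltW w0').
have P1 := Phi_gt0 w0'; have P2 := Phi_gt0 (mulr_gt0 k0 w0').
set a := Phi (k * _) in P2 *; set b := Phi _ in P1 *; move=> ab.
rewrite ler_pdivlMr ?powR_gt0// mulrC ler_pdivrMr ?powR_gt0//.
rewrite -powRM ?(ltW P1)//; apply: ge0_ler_powR => //; rewrite ?nnegrE ?mulr_ge0 ?(ltW P2) ?(ltW P1)//.
exact: le_trans p1.
Qed.

(** Substitute w / k for w: the scaling inequality for Phi bounds the change of
    the weight by phi(k)^p, the Jacobian is 1 / k, and the domain shrinks. *)
Lemma wint_scale (phi : R -> R) k F : 0 < k <= 1 -> 0 <= phi k ->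
  (forall x, 0 <= x -> Phi (k * x) <= phi k * Phi x) ->
  jointly_measurable F -> (forall s w, 0 <= F s w) ->
  (wint (fun s w => F s (k * w)%R) <= (phi k `^ p / k)%:E * wint F)%E.
Proof.
move=> /andP[k0 k1] phik0 H mF F0.
pose h w := ((weight w)%:E * \int[mu]_(s in `[0%R, L[) (F s w)%:E)%E.
have mh : measurable_fun setT h by exact: measurable_weight_slice.
have h0 w : (0 <= h w)%E by rewrite mule_ge0 ?lee_fin ?weight_ge0// slice_ge0.
apply: (@le_trans _ _ (\int[mu]_(w in `](- (L / 2))%R, (L / 2)%R[) ((phi k `^ p)%:E * h (k * w)%R))%E).
  apply: ge0_le_integral_nomeas => w _.
    by rewrite mule_ge0 ?lee_fin ?weight_ge0// slice_ge0.
  rewrite /h muleA -EFinM lee_wpmul2r ?slice_ge0// lee_fin.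
  exact: weight_scale.
rewrite ge0_integralZl_EFin; [|by []|by move=> w _; exact: h0| |exact: powR_ge0]; last first.
  apply: measurable_funTS; apply: measurableT_comp mh _; exact: measurable_funM.
rewrite ge0_integral_scale// EFinM muleA lee_wpmul2l//.
  by rewrite lee_fin divr_ge0 ?powR_ge0// ltW.
apply: ge0_subset_integral => //; first exact: measurable_funTS.
move=> w; rewrite /= !in_itv/= => /andP[w1 w2].
have : k * (L / 2) <= L / 2 by rewrite ler_piMl// divr_ge0// ltW.
by move=> kL; apply/andP; split; lra.
Qed.

(** Exchanging the two ends of the chord: s + w and - w describe the same pair of
    points as s and w. *)
Lemma wint_reflect F : jointly_measurable F -> (forall s w, 0 <= F s w) ->
  (forall s w, F (s + L) w = F s w) ->
  wint (fun s w => F (s + w) (- w)) = wint F.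
Proof.
move=> mF F0 FL.
pose h w := ((weight w)%:E * \int[mu]_(s in `[0%R, L[) (F s w)%:E)%E.
rewrite /wint -/(h _) -(@ge0_integral_opp _ _ h); first last.
- by move=> w; rewrite mule_ge0 ?lee_fin ?weight_ge0// slice_ge0.
- exact: measurable_weight_slice.
apply: eq_integral => w _; rewrite /h weightN; congr (_ * _)%E.
rewrite (@ge0_integral_shift _ w _ _ (fun s => (F s (- w))%:E)); first last.
- by move=> s; rewrite lee_fin.
- by apply/measurable_EFinP; exact: measurable_sliceF.
rewrite add0r addrC ge0_integral_period//.
- by apply/measurable_EFinP; exact: measurable_sliceF.
- by move=> s; rewrite lee_fin.
- by move=> s; rewrite FL.
Qed.

End Weighted.

(** * Secants *)
Section Secant.
Context {R : realType} {d : nat}.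
Variables (L : R) (L0 : 0 < L) (f : R -> 'rV[R]_d) (hf : arclength_embedded L f).
Local Notation mu := (@lebesgue_measure R).
Implicit Types (s t w e : R).

Definition secant s w : 'rV[R]_d := w^-1 *: (f (s + w) - f s).

Lemma secant_coord s w i :
  secant s w ord0 i = w^-1 * (coordf f i (s + w) - coordf f i s).
Proof. by rewrite !mxE. Qed.

Lemma measurable_secant i :
  measurable_fun setT (fun z : R * R => secant z.1 z.2 ord0 i).
Proof.
have mf := coordf_measurable L0 hf i.
under eq_fun do rewrite secant_coord.
apply: measurable_funM; last first.
  apply: measurable_funB; first by apply: measurableT_comp => //; exact: measurable_funD.
  exact: measurableT_comp.
exact: measurable_inv.
Qed.

Lemma secantMw s w : enorm (f (s + w) - f s) = `|w| * enorm (secant s w).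
Proof.
have [->|w0] := eqVneq w 0; first by rewrite addr0 subrr enorm0 normr0 mul0r.
by rewrite enormZ mulrA -normrM divff// normr1 mul1r.
Qed.

Lemma secant_le1 s w : enorm (secant s w) <= 1.
Proof.
have [->|w0] := eqVneq w 0; first by rewrite /secant invr0 scale0r enorm0.
have w0' : 0 < `|w| by rewrite normr_gt0.
by have := curve_lip1 L0 hf s (s + w); rewrite secantMw [s + w]addrC addrK ger_pMr.
Qed.

(** The chord over [s, s + w] is the sum of the chords over [s, s + e w] and
    [s + e w, s + w]. *)
Lemma secant_convex e s w : 0 < e < 1 ->
  secant s w = e *: secant s (e * w) + (1 - e) *: secant (s + e * w) ((1 - e) * w).
Proof.
move=> /andP[e0 e1]; have [->|w0] := eqVneq w 0.
  by rewrite /secant !mulr0 invr0 !scale0r !scaler0 addr0.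
have e10 : 1 - e != 0 by rewrite subr_eq0 gt_eqF.
have e0' : e != 0 by rewrite gt_eqF.
rewrite /secant !scalerA !invfM !mulrA (divff e10) (divff e0') !mul1r -scalerDr; congr (_ *: _).
have -> : s + e * w + (1 - e) * w = s + w by ring.
by rewrite [RHS]addrC addrA subrK.
Qed.

(** The secant at scale w is a convex combination of two vectors of the unit
    ball, one of which is the secant at scale e w; by uniform convexity their
    distance is controlled by the shortening of the chord. *)
Lemma secant_gap e s w : 0 < e < 1 ->
  e * enorm (secant s (e * w) - secant s w) ^+ 2 <= 2 * (1 - enorm (secant s w)).
Proof.
move=> e01; have /andP[e0 e1] := e01.
set u := secant s (e * w); set v := secant (s + e * w) ((1 - e) * w).
have E := secant_convex s w e01.
have -> : u - secant s w = (1 - e) *: (u - v).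
  by rewrite E -/u -/v scalerBr opprD addrA -{1}[u]scale1r -scalerBl.
have e01' : 0 <= e <= 1 by rewrite !ltW.
have := enorm_convex e01' (secant_le1 s (e * w)) (secant_le1 (s + e * w) ((1 - e) * w)).
rewrite -/u -/v -E => H; apply: le_trans H.
have n1 : `|1 - e| = 1 - e by rewrite ger0_norm// subr_ge0 ltW.
rewrite enormZ exprMn n1 mulrA; apply: ler_wpM2r; first exact: sqr_ge0.
by nra.
Qed.

Lemma cvg_secant e s w (l : 'rV[R]_d) : 0 < e < 1 -> w != 0 ->
  (forall i, is_derive s 1 (coordf f i) (l ord0 i)) ->
  forall i, secant s (e ^+ n * w) ord0 i @[n --> \oo] --> l ord0 i.
Proof.
move=> /andP[e0 e1] w0 dl i; have [df dE] := dl i.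
have -> : l ord0 i = 'D_1 (coordf f i) s by [].
pose q y := y^-1 *: (coordf f i (y *: 1 + s) - coordf f i s).
have /cvgr_dnbhsP/(_ (fun n => e ^+ n * w)) : q y @[y --> 0^'] --> 'D_1 (coordf f i) s by exact: df.
rewrite (_ : (fun n => q _) = (fun n => secant s (e ^+ n * w) ord0 i)); last first.
  apply/funext => n; rewrite /q secant_coord; congr (_ * (coordf f i _ - _)).
  by rewrite addrC; congr (_ + _); exact: mulr1.
apply; split; first by move=> n; rewrite mulf_neq0// expf_neq0// gt_eqF.
rewrite -(mul0r w); apply: cvgM; last exact: cvg_cst.
by apply: cvg_expr; rewrite ger0_norm// ltW.
Qed.

Lemma secant_periodic s w : secant (s + L) w = secant s w.
Proof. by rewrite /secant addrAC !(curve_periodic hf). Qed.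

Lemma secant_reflect s w : secant (s + w) (- w) = secant s w.
Proof. by rewrite /secant addrK invrN scaleNr -scalerN opprB. Qed.

End Secant.

(** * The energy controls the increments of the velocity *)
Lemma le_of_eq (R : realType) (x y : \bar R) : x = y -> (x <= y)%E.
Proof. by move=> ->. Qed.

Lemma mule_double (R : realType) (C : R) (T : \bar R) : 0 <= C -> (0 <= T)%E ->
  (C%:E * (T + T) = (C * 2)%:E * T)%E.
Proof.
move=> C0 T0; have -> : (C * 2)%:E = (C%:E + C%:E)%E by rewrite -EFinD; congr (_%:E); ring.
by rewrite ge0_muleDr// ge0_muleDl// lee_fin.
Qed.

(** One step of the induction over scales: A bounds the first change of scale,
    B the following ones, and D is B after rescaling. *)
Lemma half_step (R : realType) (C k : R) (A B D : \bar R) : 0 <= C ->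
  (0 <= A)%E -> (0 <= B)%E -> (0 <= D)%E -> (D <= k%:E * B)%E -> (B <= (2 * C)%:E * A)%E ->
  C * k <= 2^-1 -> (C%:E * (A + D) <= (2 * C)%:E * A)%E.
Proof.
move=> C0 A0 B0 D0 DB BA Ck; rewrite ge0_muleDr//.
have -> : (2 * C)%:E = (C%:E + C%:E)%E by rewrite -EFinD; congr (_%:E); ring.
rewrite ge0_muleDl ?lee_fin//; apply: leeD => //.
apply: (@le_trans _ _ (C%:E * (k%:E * B))%E); first by rewrite lee_wpmul2l// lee_fin.
rewrite muleA -EFinM; apply: (@le_trans _ _ ((2^-1)%:E * B)%E).
  by rewrite lee_wpmul2r ?lee_fin.
apply: (@le_trans _ _ ((2^-1)%:E * ((2 * C)%:E * A))%E).
  by rewrite lee_wpmul2l// lee_fin invr_ge0.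
by rewrite muleA -EFinM mulKf.
Qed.

Section Estimates.
Context {R : realType}.
Variables (L p : R) (Phi : R -> R).
Hypotheses (L0 : 0 < L) (p1 : 1 <= p).
Hypothesis Phi_ge0 : forall x : R, 0 <= x -> 0 <= Phi x.
Hypothesis Phi_meas : measurable_fun (`[0, +oo[ : set R) Phi.
Hypothesis Phi_0 : Phi 0 = 0.
Hypothesis Phi_C1 : forall x : R, 0 < x ->
     derivable Phi x 1 /\ {for x, continuous (Phi^`()%classic)}.
Hypothesis Phi_incr : forall x : R, 0 < x -> 0 < Phi^`()%classic x.
Context {d : nat}.
Variables (f : R -> 'rV[R]_d) (hf : arclength_embedded L f).
Local Notation mu := (@lebesgue_measure R).
Local Notation weight := (weight p Phi).
Local Notation wint := (wint L p Phi).
Local Notation secant := (secant f).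
Local Notation velocity := (velocity f).
Implicit Types (s t w e : R).

Let Phi_pos x : 0 < x -> 0 < Phi x := @Phi_gt0 _ Phi Phi_ge0 Phi_C1 Phi_incr x.
Let p0 : 0 < p. Proof. exact: lt_le_trans p1. Qed.
Let p20 : 0 < 2 * p. Proof. by rewrite mulr_gt0. Qed.

Lemma powR_inv (x : R) r : 0 <= x -> x^-1 `^ r = (x `^ r)^-1.
Proof. by move=> x0; rewrite -powR_inv1// -powRrM mulN1r powRN. Qed.

Lemma powR2M (x : R) : 0 <= x -> x `^ (2 * p) = (x ^+ 2) `^ p.
Proof. by move=> x0; rewrite powRrM powR_mulrn. Qed.

(** For |w| < L / 2, the intrinsic distance between the points of parameters s
    and s + w is |w|. *)
Definition energy_density s w : R :=
  ((Phi (enorm (f (s + w) - f s)))^-1 - (Phi `|w|)^-1) `^ p.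

Lemma measurable_curve_diff (a b : R * R -> R) :
  measurable_fun setT a -> measurable_fun setT b ->
  measurable_fun setT (fun z => enorm (f (a z) - f (b z))).
Proof.
move=> ma mb; apply: measurable_enorm => i.
under eq_fun do rewrite !mxE.
by apply: measurable_funB; apply: (measurableT_comp (coordf_measurable L0 hf i)).
Qed.

Lemma measurable_inv_Phi dT (T : measurableType dT) (h : T -> R) :
  measurable_fun setT h -> (forall x, 0 <= h x) ->
  measurable_fun setT (fun x => (Phi (h x))^-1).
Proof.
move=> mh h0; apply: measurable_inv.
rewrite (_ : (fun x => _) = (fun x => Phi `|h x|)); first exact: measurable_Phi_abs.
by apply/funext => x; rewrite ger0_norm.
Qed.

Lemma energyE : energy Phi p L f =
  (\int[mu]_(w in `](- (L / 2))%R, (L / 2)%R[) \int[mu]_(s in `[0%R, L[)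
    (energy_density s w)%:E)%E.
Proof.
pose F (z : R * R) := (((Phi (enorm (f z.2 - f z.1)))^-1
      - (Phi (circ_dist L z.1 z.2))^-1) `^ p)%:E.
have -> : energy Phi p L f = (\int[mu \x mu]_(z in `[0%R, L[ `*` `[0%R, L[) F z)%E.
  by apply: eq_integral => z _; rewrite /F (intrinsic_distE L0 hf).
have mF : measurable_fun setT F.
  apply/measurable_EFinP; apply: (measurableT_comp (measurable_powR p)).
  apply: measurable_funB; apply: measurable_inv_Phi.
  + exact: measurable_curve_diff.
  + by move=> z; exact: enorm_ge0.
  + exact: measurable_circ_dist.
  + by move=> z; exact: circ_dist_ge0.
have F0 z : (0 <= F z)%E by rewrite lee_fin powR_ge0.
have FL s t : F (s, t + L) = F (s, t) by rewrite /F/= (curve_periodic hf) circ_distD.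
rewrite (ge0_integral_circle L0 mF F0 FL).
apply: eq_integral => w; rewrite inE/= in_itv/= => wI; apply: eq_integral => s _.
by rewrite /F/= circ_dist_shift.
Qed.

Lemma jointly_measurable_secant_diff (G : R -> R -> 'rV[R]_d) :
  (forall i, measurable_fun setT (fun z : R * R => G z.1 z.2 ord0 i)) ->
  jointly_measurable (fun s w => enorm (secant s w - G s w) `^ (2 * p)).
Proof.
move=> mG; apply: (measurableT_comp (measurable_powR (2 * p))).
apply: measurable_enorm => i; rewrite (_ : (fun z => _) =
  (fun z : R * R => secant z.1 z.2 ord0 i - G z.1 z.2 ord0 i)).
  by apply: measurable_funB => //; exact: (measurable_secant L0 hf).
by apply/funext => z; rewrite !mxE.
Qed.

Lemma measurable_secant_scale k i :
  measurable_fun setT (fun z : R * R => secant z.1 (k * z.2) ord0 i).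
Proof.
apply: (@jointly_measurable_comp _ (fun s w => secant s w ord0 i)) => //.
- exact: (measurable_secant L0 hf).
- exact: measurable_funM.
Qed.

Definition scale_gap e s w := enorm (secant s w - secant s (e * w)) `^ (2 * p).

Lemma scale_gap_ge0 e s w : 0 <= scale_gap e s w.
Proof. exact: powR_ge0. Qed.

Lemma jointly_measurable_scale_gap e : jointly_measurable (scale_gap e).
Proof. exact: jointly_measurable_secant_diff (measurable_secant_scale e). Qed.

(** The mean value theorem bounds the difference of the inverses from below by
    the shortening 1 - |secant s w| of the chord, times m / Phi(|w|); uniform
    convexity bounds the shortening by the change of the secant. *)
Lemma energy_density_ge m e s w :
  0 < m -> (forall x, 0 < x <= L / 2 -> m <= log_slope Phi x) ->
  0 < e < 1 -> - (L / 2) < w < L / 2 ->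
  weight w * ((m * e / 2) `^ p * scale_gap e s w) <= energy_density s w.
Proof.
move=> m0 Hm e01 /andP[w1 w2]; have [->|w0] := eqVneq w 0.
  by rewrite /weight normr0 Phi_0 powR0 ?invr0 ?mul0r ?powR_ge0// gt_eqF.
have e0 : 0 < e by case/andP: e01.
have w0' : 0 < `|w| by rewrite normr_gt0.
have wL : `|w| <= L / 2 by rewrite ler_norml; apply/andP; split; lra.
have x0 : 0 < enorm (f (s + w) - f s).
  by apply: (curve_separated L0 hf); rewrite w0'/=; lra.
have qE : enorm (secant s w) = enorm (f (s + w) - f s) / `|w|.
  by rewrite secantMw mulrC mulKf// gt_eqF.
have xw : enorm (f (s + w) - f s) <= `|w|.
  by rewrite secantMw ger_pMr// (secant_le1 L0 hf).
have Hm' c : 0 < c <= `|w| -> m <= log_slope Phi c.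
  by move=> /andP[c0 cw]; apply: Hm; rewrite c0 (le_trans cw).
have H := inv_Phi_ge Phi_ge0 Phi_C1 Phi_incr x0 xw Hm' (ltW m0).
rewrite -qE in H.
have G := secant_gap L0 hf s w e01.
rewrite /scale_gap powR2M ?enorm_ge0// enormB /weight -powR_inv ?Phi_ge0//.
have P0 : 0 <= (Phi `|w|)^-1 by rewrite invr_ge0 Phi_ge0.
have me0 : 0 <= m * e / 2 by rewrite divr_ge0// mulr_ge0// ltW.
rewrite -powRM ?sqr_ge0// -powRM ?mulr_ge0 ?sqr_ge0//.
have P1 : 0 <= (Phi `|w|)^-1 * (m * e / 2 * enorm (secant s (e * w) - secant s w) ^+ 2).
  by rewrite mulr_ge0// mulr_ge0// sqr_ge0.
apply: ge0_ler_powR; rewrite ?nnegrE ?(ltW p0)//.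
- apply: le_trans H; rewrite mulr_ge0// mulr_ge0 ?(ltW m0)// subr_ge0.
  exact: (secant_le1 L0 hf).
- apply: le_trans H; rewrite mulrC ler_wpM2r//.
  have := ler_wpM2l (ltW m0) G; lra.
- exact: ltW.
- exact: ltW.
- exact: enorm_ge0.
- exact: enorm_ge0.
Qed.

Lemma energy_ge m e :
  0 < m -> (forall x, 0 < x <= L / 2 -> m <= log_slope Phi x) -> 0 < e < 1 ->
  (((m * e / 2) `^ p)%:E * wint (scale_gap e) <= energy Phi p L f)%E.
Proof.
move=> m0 Hm e01.
have c0 : 0 <= (m * e / 2) `^ p by exact: powR_ge0.
have F0 s w : 0 <= (m * e / 2) `^ p * scale_gap e s w by rewrite mulr_ge0 ?scale_gap_ge0.
have mF : jointly_measurable (fun s w => (m * e / 2) `^ p * scale_gap e s w).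
  by apply: measurable_funM => //; exact: jointly_measurable_scale_gap.
rewrite -(wintZ L p Phi_meas c0 (jointly_measurable_scale_gap e) (scale_gap_ge0 e)).
rewrite wintE// energyE; apply: ge0_le_integral_nomeas => w.
  by move=> _; apply: integral_ge0 => s _; rewrite lee_fin mulr_ge0// weight_ge0.
rewrite /= in_itv/= => wI; apply: ge0_le_integral_nomeas => s _.
  by rewrite lee_fin mulr_ge0// weight_ge0.
by rewrite lee_fin energy_density_ge.
Qed.

(** By the triangle inequality, n + 1 steps cost the first step plus n steps
    seen from the scale e w. Rescaling multiplies the latter by phi(e)^p / e,
    which is so small that the factor 2^(2p) lost in splitting the power
    still leaves one half, so that the bounds stay uniform in n. *)
Lemma iterated_gap_le (phi : R -> R) e n : 0 < e < 1 -> 0 <= phi e ->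
  (forall x, 0 <= x -> Phi (e * x) <= phi e * Phi x) ->
  2 `^ (2 * p) * (phi e `^ p / e) <= 2^-1 ->
  (wint (scale_gap (e ^+ n)) <= (2 * 2 `^ (2 * p))%:E * wint (scale_gap e))%E.
Proof.
move=> e01 phie0 Hphi small; have /andP[e0 e1] := e01.
set C := 2 `^ (2 * p); have C0 : 0 < C by rewrite powR_gt0.
have mg k := jointly_measurable_scale_gap k.
have g0 k := scale_gap_ge0 k.
have W0 : (0 <= wint (scale_gap e))%E by exact: wint_ge0.
elim: n => [|n IH].
  apply: (@le_trans _ _ 0%E); last by rewrite mule_ge0// lee_fin mulr_ge0// ltW.
  rewrite le_eqVlt; apply/orP; left; apply/eqP.
  apply: integral0_eq => w _; rewrite integral0_eq ?mule0// => s _.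
  by rewrite /scale_gap expr0 mul1r subrr enorm0 powR0// gt_eqF.
pose F s w := scale_gap (e ^+ n) s (e * w).
have mF : jointly_measurable F.
  by apply: (@jointly_measurable_comp _ (scale_gap (e ^+ n))) => //; exact: measurable_funM.
have F0 s w : 0 <= F s w by exact: g0.
apply: (@le_trans _ _ (wint (fun s w => C * (scale_gap e s w + F s w)))).
  apply: wint_le => s w; first exact: g0.
  apply: le_trans (powRD_le _ _ _); rewrite ?enorm_ge0 ?(ltW p20)//.
  apply: ge0_ler_powR; rewrite ?nnegrE ?addr_ge0 ?enorm_ge0 ?(ltW p20)//.
  apply: le_trans (enormD _ _); rewrite le_eqVlt; apply/orP; left; apply/eqP.
  by rewrite addrA subrK mulrA -exprSr.
have mgF : jointly_measurable (fun s w => scale_gap e s w + F s w).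
  by apply: measurable_funD; [exact: mg|exact: mF].
have gF0 s w : 0 <= scale_gap e s w + F s w := addr_ge0 (g0 e s w) (F0 s w).
rewrite (wintZ L p Phi_meas (ltW C0) mgF gF0) (wintD L p Phi_meas (mg e) mF (g0 e) F0).
have e01' : 0 < e <= 1 by rewrite e0 ltW.
have H := wint_scale L0 p1 Phi_meas Phi_0 Phi_pos e01' phie0 Hphi (mg (e ^+ n)) (g0 (e ^+ n)).
exact: (half_step (ltW C0) W0 (wint_ge0 L p Phi (g0 (e ^+ n))) (wint_ge0 L p Phi F0) H IH small).
Qed.

Definition tangent_gap s w := enorm (secant s w - velocity s) `^ (2 * p).

Lemma tangent_gap_ge0 s w : 0 <= tangent_gap s w.
Proof. exact: powR_ge0. Qed.

Lemma jointly_measurable_tangent_gap : jointly_measurable tangent_gap.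
Proof.
apply: (jointly_measurable_secant_diff (G := fun s w => velocity s)) => i.
by apply: (measurableT_comp (velocity_measurable L0 hf i)).
Qed.

(** As n tends to infinity the secants at scale e^n w tend to the velocity almost
    everywhere, and Fatou's lemma transfers the bound. *)
Lemma tangent_gap_le e B : 0 < e < 1 ->
  (forall n, (wint (scale_gap (e ^+ n)) <= B)%E) -> (wint tangent_gap <= B)%E.
Proof.
move=> e01 HB.
have mt := jointly_measurable_tangent_gap; have t0 := tangent_gap_ge0.
have mg k := jointly_measurable_scale_gap k; have g0 k := scale_gap_ge0 k.
have wF0 (F : R -> R -> R) (s w : R) : (forall s w, 0 <= F s w) -> (0 <= (weight w * F s w)%:E)%E.
  by move=> F0; rewrite lee_fin mulr_ge0// weight_ge0.
have mwF (F : R -> R -> R) : jointly_measurable F -> jointly_measurable (fun s w => weight w * F s w).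
  move=> mF; apply: measurable_funM => //.
  by apply: (measurableT_comp (measurable_weight p Phi_meas)).
apply: le_trans _ (limn_einf_le HB).
rewrite [leLHS](wintE L p Phi mt t0).
have -> : (fun n => wint (scale_gap (e ^+ n))) = (fun n =>
    \int[mu]_(w in `](- (L / 2))%R, (L / 2)%R[) \int[mu]_(s in `[0%R, L[) (weight w * scale_gap (e ^+ n) s w)%:E)%E.
  by apply/funext => n; exact: (wintE L p Phi (mg (e ^+ n)) (g0 (e ^+ n))).
have ms (F : R -> R -> R) : jointly_measurable F -> (forall s w, 0 <= F s w) ->
    measurable_fun setT (fun w => \int[mu]_(s in `[0%R, L[) (weight w * F s w)%:E)%E.
  move=> mF F0; apply: (measurable_slice _ (mwF F mF)) => s w.
  by rewrite mulr_ge0// weight_ge0.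
have i0 (F : R -> R -> R) w : (forall s w, 0 <= F s w) ->
    (0 <= \int[mu]_(s in `[0%R, L[) (weight w * F s w)%:E)%E.
  by move=> F0; apply: integral_ge0 => s _; exact: wF0.
apply: (@fatou_ae R _ _ mu `](- (L / 2))%R, (L / 2)%R[%classic
  (fun n w => \int[mu]_(s in `[0%R, L[) (weight w * scale_gap (e ^+ n) s w)%:E)%E
  (fun w => \int[mu]_(s in `[0%R, L[) (weight w * tangent_gap s w)%:E)%E).
- by [].
- by move=> n; exact: (ms _ (mg (e ^+ n)) (g0 (e ^+ n))).
- by move=> n w; exact: (i0 _ w (g0 (e ^+ n))).
- exact: (ms _ mt t0).
- by move=> w; exact: (i0 _ w t0).
apply: aeW => w _.
have msl (F : R -> R -> R) : jointly_measurable F -> measurable_fun setT (fun s => (weight w * F s w)%:E).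
  by move=> mF; apply/measurable_EFinP; exact: (measurable_sliceF w (mwF F mF)).
apply: (@fatou_ae R _ _ mu `[0%R, L[%classic
  (fun n s => (weight w * scale_gap (e ^+ n) s w)%:E) (fun s => (weight w * tangent_gap s w)%:E)).
- by [].
- by move=> n; exact: (msl _ (mg (e ^+ n))).
- by move=> n s; exact: (wF0 _ s w (g0 (e ^+ n))).
- exact: (msl _ mt).
- by move=> s; exact: (wF0 _ s w t0).
apply: ae_mono (velocity_ae hf) => s [_ _ ds] _.
apply: (weighted_powR_le_limn_einf (l := enorm (secant s w - velocity s))
  (u := fun n => enorm (secant s w - secant s (e ^+ n * w))) (weight_ge0 p Phi w) p20).
- by move=> n; exact: enorm_ge0.
- exact: enorm_ge0.
move=> wN0; have w0 : w != 0.
  apply: contra_neq wN0 => ->; rewrite /weight normr0 Phi_0 powR0 ?gt_eqF//.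
  exact: invr0.
apply: cvg_enorm => i.
rewrite (_ : (fun n => _) = (fun n => secant s w ord0 i - secant s (e ^+ n * w) ord0 i)); last first.
  by apply/funext => n; rewrite [LHS]mxE [X in _ + X]mxE.
have -> : (secant s w - velocity s) ord0 i = secant s w ord0 i - velocity s ord0 i.
  by rewrite [LHS]mxE [X in _ + X]mxE.
apply: cvgB; first exact: cvg_cst.
exact: cvg_secant ds i.
Qed.

(** The increment of the velocity splits into two tangent gaps, seen from the
    two ends of the chord. *)
Lemma velocity_increment_le :
  (wint (fun s w => enorm (velocity (s + w) - velocity s) `^ (2 * p))%R <=
   (2 `^ (2 * p) * 2)%:E * wint tangent_gap)%E.
Proof.
have mt := jointly_measurable_tangent_gap; have t0 := tangent_gap_ge0.
(* The deviation of the same secant from the velocity at its other end. *)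
pose F s w := tangent_gap (s + w) (- w).
have mF : jointly_measurable F.
  apply: (jointly_measurable_comp mt); first exact: measurable_funD.
  exact: (measurableT_comp (@oppr_measurable R setT)).
have F0 s w : 0 <= F s w by exact: t0.
have tL s w : tangent_gap (s + L) w = tangent_gap s w.
  by rewrite /tangent_gap (secant_periodic hf) (velocity_periodic hf).
have C0 : 0 <= 2 `^ (2 * p) :> R by exact: powR_ge0.
apply: (@le_trans _ _ (wint (fun s w => 2 `^ (2 * p) * (F s w + tangent_gap s w)))).
  apply: wint_le => s w; first exact: powR_ge0.
  apply: le_trans (powRD_le _ _ _); rewrite ?enorm_ge0 ?(ltW p20)//.
  apply: ge0_ler_powR; rewrite ?nnegrE ?addr_ge0 ?enorm_ge0 ?(ltW p20)//.
  rewrite secant_reflect [X in _ <= X + _]enormB.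
  by apply: le_trans (enormD _ _); rewrite addrA subrK.
have mFt : jointly_measurable (fun s w => F s w + tangent_gap s w).
  by apply: measurable_funD; [exact: mF|exact: mt].
have Ft0 s w : 0 <= F s w + tangent_gap s w := addr_ge0 (F0 s w) (t0 s w).
have E1 := wintZ L p Phi_meas C0 mFt Ft0.
have E2 := wintD L p Phi_meas mF mt F0 t0.
have E3 : wint F = wint tangent_gap := wint_reflect p L0 Phi_meas mt t0 tL.
have E2' := etrans E2 (congr1 (fun x => x + wint tangent_gap)%E E3).
apply: (le_trans (le_of_eq (etrans E1 (congr1 (fun x => (2 `^ (2 * p))%:E * x)%E E2')))).
exact: (le_of_eq (mule_double C0 (wint_ge0 L p Phi t0))).
Qed.

End Estimates.

(** * The increments of the velocity control the energy *)
Section Upper.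
Context {R : realType}.
Variables (L p : R) (Phi : R -> R).
Hypotheses (L0 : 0 < L) (p1 : 1 <= p).
Hypothesis Phi_ge0 : forall x : R, 0 <= x -> 0 <= Phi x.
Hypothesis Phi_meas : measurable_fun (`[0, +oo[ : set R) Phi.
Hypothesis Phi_0 : Phi 0 = 0.
Hypothesis Phi_C1 : forall x : R, 0 < x ->
     derivable Phi x 1 /\ {for x, continuous (Phi^`()%classic)}.
Hypothesis Phi_incr : forall x : R, 0 < x -> 0 < Phi^`()%classic x.
Variable phi : R -> R.
Hypothesis phi_ge0 : forall x : R, 0 <= x -> 0 <= phi x.
Hypothesis phi_meas : measurable_fun (`[0, +oo[ : set R) phi.
Hypothesis phi_scale : forall k x : R, 0 <= k -> 0 <= x -> Phi (k * x) <= phi k * Phi x.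
Context {d : nat}.
Variables (f : R -> 'rV[R]_d) (hf : arclength_embedded L f).
Local Notation mu := (@lebesgue_measure R).
Local Notation weight := (weight p Phi).
Local Notation wint := (wint L p Phi).
Local Notation secant := (secant f).
Local Notation velocity := (velocity f).
Local Notation energy_density := (energy_density p Phi f).
Implicit Types (s t w e b : R).

Let Phi_pos x : 0 < x -> 0 < Phi x := @Phi_gt0 _ Phi Phi_ge0 Phi_C1 Phi_incr x.
Let p0 : 0 < p. Proof. exact: lt_le_trans p1. Qed.
Let p20 : 0 < 2 * p. Proof. by rewrite mulr_gt0. Qed.

(** The mean value theorem bounds the density by the shortening of the chord over
    x Phi(x), where x is the length of the chord; the bi-Lipschitz bound and
    the scaling inequality for Phi compare x Phi(x) with |w| Phi(|w|). *)
Lemma energy_density_le M Cb s w : 0 < M -> 0 < Cb ->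
  (forall x, 0 < x <= L / 2 -> log_slope Phi x <= M) ->
  Cb * circ_dist L s (s + w) <= enorm (f (s + w) - f s) ->
  - (L / 2) < w < L / 2 ->
  energy_density s w <= weight w * (M * phi Cb^-1 / Cb * (1 - enorm (secant s w))) `^ p.
Proof.
move=> M0 Cb0 HM Hb wI; have /andP[w1 w2] := wI; have [w0|w0] := eqVneq w 0.
  rewrite /energy_density w0 addr0 subrr enorm0 normr0 Phi_0 subrr powR0 ?gt_eqF//.
  by apply: mulr_ge0; [exact: weight_ge0|exact: powR_ge0].
rewrite circ_dist_shift// in Hb.
have w0' : 0 < `|w| by rewrite normr_gt0.
have wL : `|w| <= L / 2 by rewrite ler_norml; apply/andP; split; lra.
have Cw : 0 < Cb * `|w| by rewrite mulr_gt0.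
have x0 : 0 < enorm (f (s + w) - f s) := lt_le_trans Cw Hb.
set q := enorm (secant s w); have q1 : q <= 1 := secant_le1 L0 hf s w.
have xE : enorm (f (s + w) - f s) = `|w| * q by rewrite secantMw.
have xw : enorm (f (s + w) - f s) <= `|w| by rewrite xE ger_pMr.
have HM' c : 0 < c <= `|w| -> log_slope Phi c <= M.
  by move=> /andP[c0 cw]; apply: HM; rewrite c0 (le_trans cw).
have H := inv_Phi_le Phi_ge0 Phi_C1 Phi_incr x0 xw HM'.
have H0 : 0 <= (Phi (enorm (f (s + w) - f s)))^-1 - (Phi `|w|)^-1.
  rewrite subr_ge0 lef_pV2 ?posrE ?Phi_pos//.
  exact: (Phi_le Phi_C1 Phi_incr).
have k0 : 0 <= phi Cb^-1 by apply: phi_ge0; rewrite invr_ge0 ltW.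
have Pw : 0 < Phi `|w| by exact: Phi_pos.
have PCw : 0 < Phi (Cb * `|w|) by exact: Phi_pos.
have PP : Phi `|w| <= phi Cb^-1 * Phi (Cb * `|w|).
  have Ci0 : 0 <= Cb^-1 by rewrite invr_ge0 ltW.
  by have := phi_scale Ci0 (ltW Cw); rewrite mulrA mulVf ?gt_eqF// mul1r.
set x := enorm (f (s + w) - f s) in x0 xE xw H H0 *.
have Px : Phi (Cb * `|w|) <= Phi x by exact: (Phi_le Phi_C1 Phi_incr).
have den : Cb * `|w| * Phi `|w| <= phi Cb^-1 * (x * Phi x).
  apply: (@le_trans _ _ (Cb * `|w| * (phi Cb^-1 * Phi (Cb * `|w|)))).
    by rewrite ler_pM2l.
  rewrite mulrCA; apply: ler_wpM2l => //.
  by apply: ler_pM => //; exact: ltW.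
have key : (Phi x)^-1 - (Phi `|w|)^-1 <= (Phi `|w|)^-1 * (M * phi Cb^-1 / Cb * (1 - q)).
  apply: (le_trans H); rewrite ler_pdivrMr; last by rewrite mulr_gt0// Phi_pos.
  have -> : (Phi `|w|)^-1 * (M * phi Cb^-1 / Cb * (1 - q)) * (x * Phi x) =
            M * (1 - q) * (phi Cb^-1 * (x * Phi x)) / (Cb * Phi `|w|).
    by field; rewrite !gt_eqF.
  rewrite ler_pdivlMr ?mulr_gt0//.
  have -> : M * (`|w| - x) * (Cb * Phi `|w|) = M * (1 - q) * (Cb * `|w| * Phi `|w|).
    by rewrite xE; ring.
  by rewrite ler_wpM2l// mulr_ge0 ?(ltW M0)// subr_ge0.
have A0 : 0 <= M * phi Cb^-1 / Cb * (1 - q).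
  apply: mulr_ge0; last by rewrite subr_ge0.
  by apply: divr_ge0; [apply: mulr_ge0 => //; exact: ltW|exact: ltW].
rewrite /weight -powR_inv ?Phi_ge0// -powRM ?invr_ge0 ?Phi_ge0//.
apply: ge0_ler_powR; rewrite ?nnegrE ?(ltW p0)//.
by apply: mulr_ge0 => //; rewrite invr_ge0 Phi_ge0.
Qed.

Lemma velocity_measurable_affine s w i : measurable_fun setT (fun b => velocity (s + b * w) ord0 i).
Proof.
apply: (measurableT_comp (velocity_measurable L0 hf i)).
by apply: measurable_funD => //; exact: measurable_funM.
Qed.

(** For unit vectors, |v(s + b w) - v(s)|^2 = 2 - 2 v(s).v(s + b w), which
    integrates in b to 2 (1 - v(s).q), where q is the secant at s and w; and
    v(s).q <= |q|. *)
Lemma secant_defect_le s w : w != 0 -> enorm (velocity s) = 1 ->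
  exists m, (\int[mu]_(b in `]0%R, 1%R]) (enorm (velocity (s + b * w) - velocity s) ^+ 2)%:E = m%:E)%E
   /\ 1 - enorm (secant s w) <= m / 2.
Proof.
move=> w0 v1; have [K HK] := curve_dot_lip L0 hf (velocity s).
(* A primitive of the squared deviation. *)
pose h b := 2 * b - 2 / w * dot (velocity s) (f (s + b * w)).
pose k b := enorm (velocity (s + b * w) - velocity s) ^+ 2.
have hK : lipschitz_with (2 + `|2 / w| * (`|K| * `|w|)) h.
  move=> x y; have -> : h x - h y = 2 * (x - y) -
      2 / w * (dot (velocity s) (f (s + x * w)) - dot (velocity s) (f (s + y * w))).
    by rewrite /h; ring.
  apply: (le_trans (ler_normB _ _)); rewrite [leRHS]mulrDl; apply: lerD.
    by rewrite normrM ger0_norm.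
  rewrite normrM -mulrA; apply: ler_wpM2l => //.
  apply: (le_trans (HK _ _)); have -> : s + x * w - (s + y * w) = w * (x - y) by ring.
  rewrite normrM -mulrA; apply: ler_wpM2r; last exact: ler_norm.
  by rewrite mulr_ge0.
have mk : measurable_fun setT k.
  apply: measurable_funX; apply: measurable_enorm => i; under eq_fun do rewrite !mxE.
  rewrite (_ : (fun x => _) = (fun x => velocity (s + x * w) ord0 i - velocity s ord0 i)).
    by apply: measurable_funB => //; exact: velocity_measurable_affine.
  by apply/funext => x; rewrite !mxE.
have dk : {ae mu, forall b, is_derive b 1 h (k b)}.
  apply: ae_mono (ae_affine s w0 (velocity_ae hf)) => b; rewrite mulrC addrC => -[_ vb1 db].
  have dd := dot_derive (velocity s) db.
  have d1 : is_derive b 1 (fun b => s + b * w) w.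
    have -> : (fun b => s + b * w) = (fun b => w *: b + s).
      by apply/funext => y; rewrite addrC mulrC.
    have -> : is_derive b 1 (fun b => w *: b + s) w =
              is_derive b 1 (fun b => w *: b + s) (w *: 1 + 0).
      by rewrite addr0 -[X in _ = is_derive _ _ _ X]/(w * 1) mulr1.
    by apply: is_deriveD; apply: is_deriveZ.
  have d2 := @is_derive1_comp R (fun x => dot (velocity s) (f x)) (fun b => s + b * w) b _ _ dd d1.
  have d3 : is_derive b 1 h (2 *: 1 - (2 / w) *: (dot (velocity s) (velocity (s + b * w)) * w)).
    have -> : h = (fun b => 2 *: b - (2 / w) *: dot (velocity s) (f (s + b * w))) by [].
    by apply: is_deriveB; apply: is_deriveZ.
  have -> : k b = 2 *: 1 - (2 / w) *: (dot (velocity s) (velocity (s + b * w)) * w).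
    rewrite /k enorm_sqr !(dotDl, dotDr, dotNl, dotNr) -!enorm_sqr v1 vb1 (dotC (velocity (s + b * w))).
    rewrite -[2 *: 1]/(2 * 1) -[_ *: _]/(2 / w * _); field; exact: w0.
  exact: d3.
have [_ E] := lipschitz_FTC ltr01 hK mk dk.
exists (h 1 - h 0); split.
  rewrite -E integral_itv_obnd_cbnd//; apply/measurable_EFinP; exact: measurable_funTS.
have := dot_le (velocity s) (secant s w); rewrite v1 mul1r.
have -> : h 1 - h 0 = 2 * (1 - dot (velocity s) (secant s w)).
  by rewrite /h /secant dotZr dotDr dotNr mul1r mul0r addr0; field; exact: w0.
lra.
Qed.

Definition velocity_gap s w := enorm (velocity (s + w) - velocity s) `^ (2 * p).

Lemma velocity_gap_ge0 s w : 0 <= velocity_gap s w.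
Proof. exact: powR_ge0. Qed.

Lemma jointly_measurable_velocity_gap : jointly_measurable velocity_gap.
Proof.
apply: (measurableT_comp (measurable_powR (2 * p))); apply: measurable_enorm => i.
rewrite (_ : (fun z => _) =
  (fun z : R * R => velocity (z.1 + z.2) ord0 i - velocity z.1 ord0 i)); last first.
  by apply/funext => z; rewrite [LHS]mxE [X in _ + X]mxE.
apply: measurable_funB.
  by apply: (measurableT_comp (velocity_measurable L0 hf i)); exact: measurable_funD.
by apply: (measurableT_comp (velocity_measurable L0 hf i)).
Qed.

Lemma secant_defect_powR_le s w : w != 0 -> enorm (velocity s) = 1 ->
  (((1 - enorm (secant s w)) `^ p)%:E <= \int[mu]_(b in `]0%R, 1%R]) (velocity_gap s (b * w))%:E)%E.
Proof.
move=> w0 v1; have [m [mE ml]] := secant_defect_le w0 v1.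
pose k b := enorm (velocity (s + b * w) - velocity s) ^+ 2.
have mk : measurable_fun setT k.
  apply: measurable_funX; apply: measurable_enorm => i.
  rewrite (_ : (fun x => _) = (fun x => velocity (s + x * w) ord0 i - velocity s ord0 i)).
    by apply: measurable_funB => //; exact: velocity_measurable_affine.
  by apply/funext => x; rewrite [LHS]mxE [X in _ + X]mxE.
have k0 b : 0 <= k b by exact: sqr_ge0.
have m1 : mu `]0%R, 1%R]%classic = 1%E.
  by rewrite lebesgue_measure_itv/= lte_fin ltr01 oppr0 adde0.
have q0 : 0 <= 1 - enorm (secant s w) by rewrite subr_ge0 (secant_le1 L0 hf).
have m0 : 0 <= m by lra.
apply: (@le_trans _ _ (m `^ p)%:E).
  rewrite lee_fin; apply: ge0_ler_powR; rewrite ?nnegrE ?(ltW p0)//; lra.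
have -> : (\int[mu]_(b in `]0%R, 1%R]) (velocity_gap s (b * w))%:E =
           \int[mu]_(b in `]0%R, 1%R]) (k b `^ p)%:E)%E.
  by apply: eq_integral => b _; rewrite /velocity_gap powR2M ?enorm_ge0.
exact: (jensen_powR _ m1 p1 mk k0 mE).
Qed.

Lemma energy_density_le_integral M Cb s w : 0 < M -> 0 < Cb ->
  (forall x, 0 < x <= L / 2 -> log_slope Phi x <= M) ->
  Cb * circ_dist L s (s + w) <= enorm (f (s + w) - f s) ->
  - (L / 2) < w < L / 2 -> enorm (velocity s) = 1 ->
  ((energy_density s w)%:E <= (weight w * (M * phi Cb^-1 / Cb) `^ p)%:E *
    \int[mu]_(b in `]0%R, 1%R]) (velocity_gap s (b * w))%:E)%E.
Proof.
move=> M0 Cb0 HM Hb wI v1; have H := energy_density_le M0 Cb0 HM Hb wI.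
have [w0|w0] := eqVneq w 0.
  have wt0 : weight w = 0 by rewrite /weight w0 normr0 Phi_0 powR0 ?gt_eqF// invr0.
  by rewrite wt0 mul0r in H; rewrite wt0 mul0r mul0e lee_fin.
have k0 : 0 <= phi Cb^-1 by apply: phi_ge0; rewrite invr_ge0 ltW.
have A0 : 0 <= M * phi Cb^-1 / Cb.
  by apply: divr_ge0; [apply: mulr_ge0 => //; exact: ltW|exact: ltW].
have q0 : 0 <= 1 - enorm (secant s w) by rewrite subr_ge0 (secant_le1 L0 hf).
rewrite powRM// mulrA in H; rewrite -lee_fin in H; apply: (le_trans H).
rewrite EFinM; apply: lee_wpmul2l; last exact: secant_defect_powR_le.
by rewrite lee_fin; apply: mulr_ge0; [exact: weight_ge0|exact: powR_ge0].
Qed.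

Lemma measurable_energy_density : jointly_measurable energy_density.
Proof.
apply: (measurableT_comp (measurable_powR p)); apply: measurable_funB.
  apply: (measurable_inv_Phi Phi_meas) => [|z]; last exact: enorm_ge0.
  by apply: (measurable_curve_diff L0 hf) => //; exact: measurable_funD.
apply: (measurable_inv_Phi Phi_meas) => [|z]; last exact: normr_ge0.
exact: (measurableT_comp (@normr_measurable R setT)).
Qed.

(** Average the bound of the density over the position b along the arc: the
    contribution of a fixed b is a rescaled seminorm, whose scaling costs
    phi(b)^p / b, which is integrable on ]0, 1]. *)
Lemma energy_lty M Cb : 0 < M -> 0 < Cb ->
  (forall x, 0 < x <= L / 2 -> log_slope Phi x <= M) ->
  (forall s t, Cb * circ_dist L s t <= enorm (f t - f s)) ->
  (Mint phi p 1 < +oo)%E -> (wint velocity_gap < +oo)%E ->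
  (energy Phi p L f < +oo)%E.
Proof.
move=> M0 Cb0 HM Hb Mfin Wfin.
have [A A0 ED] : exists2 A, 0 <= A & forall s w, - (L / 2) < w < L / 2 -> enorm (velocity s) = 1 ->
    ((energy_density s w)%:E <= (weight w * A)%:E *
      \int[mu]_(b in `]0%R, 1%R]) (velocity_gap s (b * w))%:E)%E.
  exists ((M * phi Cb^-1 / Cb) `^ p) => [|s w wI v1]; first exact: powR_ge0.
  exact: energy_density_le_integral (Hb s (s + w)) wI v1.
have mg := jointly_measurable_velocity_gap; have g0 := velocity_gap_ge0.
pose h u : \bar R := (\int[mu]_(s in `[0%R, L[) (velocity_gap s u)%:E)%E.
have mh : measurable_fun setT h by exact: measurable_slice.
have h0 u : (0 <= h u)%E by exact: slice_ge0.
have mgb w : measurable_fun setT (fun z : R * R => (velocity_gap z.1 (z.2 * w))%:E).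
  apply/measurable_EFinP; apply: (jointly_measurable_comp mg) => //.
  exact: measurable_funM.
have gb0 w (z : R * R) : (0 <= (velocity_gap z.1 (z.2 * w))%:E)%E by rewrite lee_fin.
have mw : measurable_fun setT (fun w => (weight w)%:E).
  by apply/measurable_EFinP; exact: measurable_weight.
have w0 w : (0 <= (weight w)%:E)%E by rewrite lee_fin weight_ge0.
have mhb : measurable_fun setT (fun z : R * R => ((weight z.1)%:E * h (z.2 * z.1)%R)%E).
  apply: emeasurable_funM; first exact: (measurableT_comp mw).
  by apply: (measurableT_comp mh); exact: measurable_funM.
have hb0 (z : R * R) : (0 <= (weight z.1)%:E * h (z.2 * z.1)%R)%E by exact: mule_ge0.
have mhw w : measurable_fun setT (fun b => h (b * w)).
  by apply: (measurableT_comp mh); exact: measurable_funM.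
have step1 w : - (L / 2) < w < L / 2 ->
    (\int[mu]_(s in `[0%R, L[) (energy_density s w)%:E <=
     (A%:E * \int[mu]_(b in `]0%R, 1%R]) ((weight w)%:E * h (b * w)%R)))%E.
  move=> wI.
  have -> : (A%:E * \int[mu]_(b in `]0%R, 1%R]) ((weight w)%:E * h (b * w)%R))%E =
      (\int[mu]_(s in `[0%R, L[) ((weight w * A)%:E *
        \int[mu]_(b in `]0%R, 1%R]) (velocity_gap s (b * w))%:E))%E.
    have wA0 : 0 <= weight w * A by rewrite mulr_ge0// weight_ge0.
    have mbw : measurable_fun setT (fun s => \int[mu]_(b in `]0%R, 1%R]) (velocity_gap s (b * w))%:E)%E.
      by apply: (@measurable_integral_section _ _ _ _ R mu _ _ _ (mgb w)).
    have -> : (\int[mu]_(b in `]0%R, 1%R]) ((weight w)%:E * h (b * w)%R) =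
               (weight w)%:E * \int[mu]_(b in `]0%R, 1%R]) h (b * w)%R)%E.
      apply: ge0_integralZl_EFin; [by []|by move=> b _; exact: h0| |exact: weight_ge0].
      by apply: measurable_funTS; exact: mhw.
    rewrite [RHS]ge0_integralZl_EFin; first last.
    - exact: wA0.
    - by apply: measurable_funTS; exact: mbw.
    - by move=> s _; apply: integral_ge0 => b _; exact: (gb0 w (s, b)).
    - by [].
    have wAE : (weight w * A)%:E = (A%:E * (weight w)%:E)%E.
      exact: etrans (congr1 EFin (mulrC (weight w) A)) (EFinM A (weight w)).
    have swap : (\int[mu]_(b in `]0%R, 1%R]) h (b * w)%R =
        \int[mu]_(s in `[0%R, L[) \int[mu]_(b in `]0%R, 1%R]) (velocity_gap s (b * w))%:E)%E.
      by rewrite /h; apply: esym; apply: (tonelli_set_swap mu mu _ _ (mgb w) (gb0 w)).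
    rewrite wAE swap; exact: muleA.
  apply: ae_ge0_le_integral => //.
  - by move=> s _; rewrite lee_fin powR_ge0.
  - apply/measurable_EFinP/measurable_funTS; exact: (measurable_sliceF w measurable_energy_density).
  - move=> s _; apply: mule_ge0; first by rewrite lee_fin mulr_ge0// weight_ge0.
    by apply: integral_ge0 => b _; rewrite lee_fin.
  - apply: measurable_funTS; apply: emeasurable_funM; first exact: measurable_cst.
    by apply: (@measurable_integral_section _ _ _ _ R mu _ _ _ (mgb w)).
  - apply: ae_mono (velocity_ae hf) => s [_ v1 _] _.
    exact: ED.
rewrite (energyE p L0 Phi_meas hf).
apply: (@le_lt_trans _ _ (A%:E * (Mint phi p 1 * wint velocity_gap))%E); last first.
  rewrite lte_mul_pinfty ?lee_fin//; apply: lte_mul_pinfty => //.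
    by apply: integral_ge0 => b; rewrite /= in_itv/= => /andP[b0 _]; rewrite lee_fin divr_ge0 ?powR_ge0// ltW.
  rewrite ge0_fin_numE//; apply: integral_ge0 => b; rewrite /= in_itv/= => /andP[b0 _].
  by rewrite lee_fin divr_ge0 ?powR_ge0// ltW.
apply: (@le_trans _ _ (\int[mu]_(w in `](- (L / 2))%R, (L / 2)%R[)
    (A%:E * \int[mu]_(b in `]0%R, 1%R]) ((weight w)%:E * h (b * w)%R)))%E).
  apply: ge0_le_integral_nomeas => w.
    by move=> _; apply: integral_ge0 => s _; rewrite lee_fin powR_ge0.
  by rewrite /= in_itv/= => wI; exact: step1.
rewrite ge0_integralZl_EFin//; last 2 first.
- by move=> w _; apply: integral_ge0 => b _; exact: (hb0 (w, b)).
- by apply: measurable_funTS; exact: (@measurable_integral_section _ _ _ _ R mu _ _ _ mhb).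
apply: lee_wpmul2l; first by rewrite lee_fin.
rewrite (@tonelli_set_swap _ _ _ _ R mu mu _ _ _ _ _ mhb hb0)//.
have W0 := wint_ge0 L p Phi g0.
have Wf : wint velocity_gap \is a fin_num by rewrite ge0_fin_numE.
rewrite -(fineK Wf) muleC /Mint -ge0_integralZl_EFin ?fine_ge0//; last 2 first.
- by move=> b; rewrite /= in_itv/= => /andP[b0 _]; rewrite lee_fin divr_ge0 ?powR_ge0// ltW.
- apply/measurable_EFinP; apply: measurable_funM.
    apply: (measurableT_comp (measurable_powR p)); apply: (measurable_funS _ _ phi_meas) => //.
    by apply: subset_itv; rewrite bnd_simp.
  by apply: measurable_funTS; exact: measurable_inv.
apply: ge0_le_integral_nomeas => b.
  by move=> _; apply: integral_ge0 => w _; exact: (hb0 (w, b)).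
rewrite /= in_itv/= => b01; rewrite fineK// muleC; have /andP[b0 b1] := b01.
exact: (wint_scale L0 p1 Phi_meas Phi_0 Phi_pos b01 (phi_ge0 (ltW b0)) (fun x x0 => phi_scale (ltW b0) x0) mg g0).
Qed.

End Upper.

(** * The velocity is the weak derivative *)
Lemma adde_eq0N (R : realType) (x y : \bar R) : x \is a fin_num -> 0%E = (x + y)%E ->
  y = (- x)%E.
Proof.
by case: x => [x| |]//; case: y => [y| |]//= _ [] E; congr (_%:E); lra.
Qed.

Section WeakDerivative.
Context {R : realType} {d : nat}.
Variables (L : R) (L0 : 0 < L) (f : R -> 'rV[R]_d) (hf : arclength_embedded L f).
Local Notation mu := (@lebesgue_measure R).
Local Notation velocity := (velocity f).
Implicit Types (h eta : R -> R) (x y a b : R).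

Lemma periodic_bounded h : continuous h -> periodic h L ->
  exists2 M, 0 <= M & forall x, `|h x| <= M.
Proof.
move=> ch hL; have cn : {within `[0, L], continuous (fun x => `|h x|)}.
  apply: continuous_subspaceT => x; by apply: cvg_norm; exact: ch.
have [c _ H] := EVT_max (ltW L0) cn.
exists `|h c| => // x; rewrite -(circ_mod_periodic x hL); apply: H.
by rewrite in_itv/= (circ_mod_ge0 L0) ltW// circ_mod_lt.
Qed.

Lemma derive1_periodic h : periodic h L -> periodic (h^`()%classic) L.
Proof.
move=> hL x; rewrite /derive1.
have -> : (fun y => y^-1 *: (h (y + (x + L)) - h (x + L))) = (fun y => y^-1 *: (h (y + x) - h x)).
  by apply/funext => y /=; rewrite addrA !hL.
by [].
Qed.

Lemma bounded_derive_lipschitz h M : (forall x, derivable h x 1) ->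
  (forall x, `|h^`()%classic x| <= M) -> lipschitz_with M h.
Proof.
move=> dh hM x y; wlog xy : x y / y < x.
  move=> H; case: (ltgtP y x) => [|xy|->]; first exact: H.
    by rewrite distrC [X in _ * X]distrC; exact: H.
  by rewrite !subrr normr0 mulr0.
have dh' (z : R) : is_derive z 1 h (h^`()%classic z) by split => //; rewrite derive1E.
have [|c _ ->] := @MVT _ h (h^`()%classic) y x xy.
- apply: continuous_subspaceT => z.
  exact/differentiable_continuous/derivable1_diffP.
- by rewrite normrM ler_wpM2r.
Qed.

Section TestFunction.
Variable eta : R -> R.
Hypotheses (etaL : periodic eta L)
  (eta_smooth : forall n (s : R), derivable (eta^`(n)%classic) s 1).

Lemma test_derivable (s : R) : derivable eta s 1.
Proof. by rewrite -[eta]derive1n0. Qed.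

Lemma test_derive (s : R) : is_derive s 1 eta (eta^`()%classic s).
Proof. by split; [exact: test_derivable|rewrite derive1E]. Qed.

Lemma test_continuous : continuous eta.
Proof.
by move=> s; apply/differentiable_continuous/derivable1_diffP; exact: test_derivable.
Qed.

Lemma test_derive_continuous : continuous (eta^`()%classic).
Proof.
move=> s; rewrite -derive1n1.
have d1 : derivable (eta^`(1)%classic) s 1 := @eta_smooth 1%N s.
exact/differentiable_continuous/derivable1_diffP.
Qed.

Lemma test_coord_lip i : exists K, lipschitz_with K (fun s => eta s * coordf f i s).
Proof.
have fL : periodic (coordf f i) L by move=> x; rewrite /coordf (curve_periodic hf).
have [M M0 HM] := periodic_bounded test_continuous etaL.
have [M' M'0 HM'] := periodic_bounded test_derive_continuous (derive1_periodic etaL).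
have ci : continuous (coordf f i) by exact: (@coordf_continuous _ _ _ L0 _ hf i).
have [N N0 HN] := periodic_bounded ci fL.
have [K HK] := coordf_lip L0 hf i.
have He := bounded_derive_lipschitz test_derivable HM'.
exists (M * K + N * M') => x y.
have -> : eta x * coordf f i x - eta y * coordf f i y =
  eta x * (coordf f i x - coordf f i y) + coordf f i y * (eta x - eta y) by ring.
apply: le_trans (ler_normD _ _) _; rewrite !normrM mulrDl -!mulrA; apply: lerD.
  by apply: ler_pM => //; exact: HK.
by apply: ler_pM => //; exact: He.
Qed.

(** Integration by parts over a period: the product of the test function with
    the curve is Lipschitz and periodic. *)
Lemma integration_by_parts_curve i :
  mu.-integrable `[0, L] (EFin \o (fun s => eta s * velocity s ord0 i)) /\
  (\int[mu]_(s in `[0%R, L[) (eta^`()%classic s * coordf f i s)%:E =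
   - \int[mu]_(s in `[0%R, L[) (eta s * velocity s ord0 i)%:E)%E.
Proof.
have [K HK] := test_coord_lip i.
have meta : measurable_fun setT eta := continuous_measurable_fun test_continuous.
have meta' : measurable_fun setT (eta^`()%classic) := continuous_measurable_fun test_derive_continuous.
have mv := velocity_measurable L0 hf i.
have mf := coordf_measurable L0 hf i.
have mk : measurable_fun setT (fun s => eta s * velocity s ord0 i + eta^`()%classic s * coordf f i s).
  by apply: measurable_funD; exact: measurable_funM.
have dk : {ae mu, forall s : R, is_derive s 1 (fun s => eta s * coordf f i s)
    (eta s * velocity s ord0 i + eta^`()%classic s * coordf f i s)}.
  apply: ae_mono (velocity_ae hf) => s [_ _ /(_ i) ds].
  rewrite [X in _ + X]mulrC; exact: (is_deriveM (test_derive s) ds).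
have [ik E] := lipschitz_FTC L0 HK mk dk.
have i1 : mu.-integrable `[0, L] (EFin \o (fun s => eta^`()%classic s * coordf f i s)).
  apply: continuous_integrable_itv => s; apply: cvgM; first exact: test_derive_continuous.
  exact: (@coordf_continuous _ _ _ L0 _ hf i).
have i2 : mu.-integrable `[0, L] (EFin \o (fun s => eta s * velocity s ord0 i)).
  have mI : measurable (`[0, L]%classic : set (measurableTypeR R)) by [].
  have H := integrableB mI ik i1.
  apply: (@eq_integrable _ _ _ mu `[0, L]%classic mI _ _ _ H) => s _ /=.
  by rewrite -EFinB addrK.
split => //.
have eL : eta L * coordf f i L - eta 0 * coordf f i 0 = 0.
  by rewrite /coordf -[L]add0r etaL (curve_periodic hf) subrr.
rewrite eL in E.
have c0 h : measurable_fun setT h -> (\int[mu]_(s in `[0%R, L[) (h s)%:E = \int[mu]_(s in `[0%R, L]) (h s)%:E)%E.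
  by move=> mh; apply: integral_itv_bndo_bndc; apply/measurable_EFinP; exact: measurable_funTS.
rewrite !c0; [|exact: measurable_funM|exact: measurable_funM].
have mI : measurable (`[0, L]%classic : set (measurableTypeR R)) by [].
have S := @integralD_EFin _ _ _ mu `[0, L]%classic mI _ _ i2 i1.
have {}S : (0%E = \int[mu]_(s in `[0%R, L]) (eta s * velocity s ord0 i)%:E +
          \int[mu]_(s in `[0%R, L]) (eta^`()%classic s * coordf f i s)%:E)%E.
  by apply: (etrans (esym E)); rewrite -S; apply: eq_integral.
have f2 := integrable_fin_num mI i2.
exact: (adde_eq0N f2 S).
Qed.
End TestFunction.

Lemma velocity_weak_deriv : weak_deriv L 1 f velocity.
Proof.
move=> eta etaL eta_smooth i; rewrite derive1n1 expr1.
have [_ E] := integration_by_parts_curve etaL eta_smooth i.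
rewrite EFinN mulN1e; exact: E.
Qed.

(** The line is the countable union of the translates of a period. *)
Lemma ae_periodic (P : R -> Prop) : (forall x, P (x + L) <-> P x) ->
  {ae mu, forall x, `[0, L[%classic x -> P x} -> {ae mu, forall x, P x}.
Proof.
move=> PL H.
have shift c : {ae mu, forall x, 0 <= x + c < L -> P (x + c)}.
  have := @ae_affine R 1 c _ (oner_neq0 _) H; apply: ae_mono => x.
  by rewrite mul1r /= in_itv.
have Hp : {ae mu, forall x (n : nat), 0 <= x + n%:R * L < L -> P (x + n%:R * L)}.
  by apply: ae_foralln => n; exact: shift.
have Hn : {ae mu, forall x (n : nat), 0 <= x - n%:R * L < L -> P (x - n%:R * L)}.
  by apply: ae_foralln => n; exact: shift.
have PLn (n : nat) x : P (x + n%:R * L) <-> P x.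
  elim: n x => [|n IH] x; first by rewrite mul0r addr0.
  by rewrite -natr1 mulrDl mul1r addrA PL.
apply: ae_mono (ae_and Hp Hn) => x [hp hn].
have := circ_mod_ge0 L0 x; have := circ_mod_lt L0 x; rewrite /circ_mod.
case: (Num.floor (x / L)) => n h1 h2.
  rewrite -(subrK (n%:R * L) x); apply/PLn; apply: hn.
  by rewrite mulrC; apply/andP.
apply/(PLn n.+1); apply: hp.
by move: h1 h2; rewrite NegzE mulrNz mulrN opprK mulrC => -> ->.
Qed.

(** Testing against windows, which converge to indicators, shows that a weak
    derivative and the velocity have the same integrals over intervals, so
    that they agree at the Lebesgue points of their difference. *)
Lemma weak_deriv_unique q (g : R -> 'rV[R]_d) : 1 <= q -> in_Lq L q g -> weak_deriv L 1 f g ->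
  {ae mu, forall s, g s = velocity s}.
Proof.
move=> q1 [gL mg gq] gw.
have Fae := ae_filter_ringOfSetsType mu.
suff H i : {ae mu, forall s, g s ord0 i = velocity s ord0 i}.
  have : {ae mu, forall s, forall i, g s ord0 i = velocity s ord0 i} by apply: filter_forall.
  by apply: ae_mono => s gs; apply/rowP.
pose mI : measurable (`[0, L[%classic : set (measurableTypeR R)) := measurable_itv _.
pose u s := g s ord0 i - velocity s ord0 i.
have mv := velocity_measurable L0 hf i.
have mgi := mg i.
have mu_ : measurable_fun setT u by exact: measurable_funB.
have q0 : 0 < q by exact: lt_le_trans q1.
have ig : mu.-integrable `[0, L[ (EFin \o (fun s => g s ord0 i)).
  have mgq : measurable_fun setT (fun s => enorm (g s) `^ q).
    by apply: (measurableT_comp (measurable_powR q)); exact: measurable_enorm.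
  have iq : mu.-integrable `[0, L[ (EFin \o (fun s => enorm (g s) `^ q)).
    apply/integrableP; split; first by apply/measurable_EFinP; exact: measurable_funTS.
    have gq' := lty_poweRy (lt0r_neq0 (etrans (invr_gt0 q) q0)) gq.
    apply: le_lt_trans gq'; rewrite le_eqVlt; apply/orP; left; apply/eqP.
    by apply: eq_integral => s _ /=; rewrite ger0_norm// powR_ge0.
  have i1 : mu.-integrable `[0, L[ (EFin \o (cst (1 : R))).
    have := @continuous_integrable_itv R (cst 1) 0 L (@cst_continuous _ _ _).
    apply: integrableS => //; apply: subset_itvl; rewrite bnd_simp; exact: lexx.
  apply: le_integrable (integrableD mI i1 iq) => //.
    by apply/measurable_EFinP; exact: measurable_funTS.
  move=> s _ /=; rewrite lee_fin [leRHS]ger0_norm ?addr_ge0 ?powR_ge0//.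
  apply: (le_trans (coord_le_enorm _ _)).
  have [e1|e1] := leP (enorm (g s)) 1; first by rewrite (le_trans e1)// lerDl powR_ge0.
  rewrite -[leLHS](powRr1 (enorm_ge0 _)) (le_trans (ler_powR (ltW e1) q1))// lerDr//.
have iv : mu.-integrable `[0, L[ (EFin \o (fun s => velocity s ord0 i)).
  have sm1 n := (elementary_smooth n (elem_cst (1 : R))).2.
  (* The constant 1 is a test function. *)
  have [H _] := integration_by_parts_curve (eta := fun=> 1) (fun=> erefl) sm1 i.
  have mI' : measurable (`[0, L]%classic : set (measurableTypeR R)) by [].
  have sub : `[0, L[%classic `<=` (`[0, L]%classic : set R).
    by apply: subset_itvl; rewrite bnd_simp.
  apply: (@eq_integrable _ _ _ mu `[0, L[%classic mI _ _ _ (integrableS mI' mI sub H)) => s _ /=.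
  by rewrite mul1r.
have iu : mu.-integrable `[0, L[ (EFin \o u).
  by apply: (@eq_integrable _ _ _ mu `[0, L[%classic mI _ _ _ (integrableB mI ig iv)).
have zero a b : 0 <= a -> a < b -> b <= L ->
    (\int[mu]_(s in `[0%R, L[) (\1_(`]a, b[%classic) s * u s)%:E = 0)%E.
  move=> a0 ab bL.
  have wn n : (\int[mu]_(s in `[0%R, L[) (window L a b n s * u s)%:E = 0)%E.
    have wL := window_periodic a b n (lt0r_neq0 L0).
    have sm k := (elementary_smooth k (elementary_window L a b n)).2.
    have mw : measurable_fun setT (window L a b n) := continuous_measurable_fun (test_continuous sm).
    have iw h : measurable_fun setT h -> mu.-integrable `[0, L[ (EFin \o h) ->
        mu.-integrable `[0, L[ (EFin \o (fun s => window L a b n s * h s)).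
      move=> mh; apply: le_integrable => //.
        by apply/measurable_EFinP; apply: measurable_funTS; exact: measurable_funM.
      move=> s _ /=; rewrite lee_fin normrM ger0_norm ?window_ge0//.
      by rewrite ler_piMl// window_le1.
    have E1 := gw _ wL sm i; rewrite derive1n1 expr1 EFinN mulN1e in E1.
    have [_ E2] := integration_by_parts_curve wL sm i.
    have E : (\int[mu]_(s in `[0%R, L[) (window L a b n s * g s ord0 i)%:E =
              \int[mu]_(s in `[0%R, L[) (window L a b n s * velocity s ord0 i)%:E)%E.
      by apply: oppe_inj; exact: (etrans (esym E1) E2).
    transitivity (\int[mu]_(s in `[0%R, L[) ((window L a b n s * g s ord0 i)%:E
        - (window L a b n s * velocity s ord0 i)%:E))%E.
      by apply: eq_integral => s _; rewrite -EFinB -mulrBr.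
    rewrite (integralB_EFin mI (iw _ mgi ig) (iw _ mv iv)) E subee//.
    exact: (integrable_fin_num mI (iw _ mv iv)).
  have [] := @dominated_convergence _ _ _ mu `[0, L[%classic mI
    (fun n s => (window L a b n s * u s)%:E) (fun s => (\1_(`]a, b[%classic) s * u s)%:E)
    (fun s => `|(u s)%:E|%E).
  - move=> n; apply/measurable_EFinP; apply: measurable_funTS; apply: measurable_funM => //.
    have sm k := (elementary_smooth k (elementary_window L a b n)).2.
    exact: (continuous_measurable_fun (test_continuous sm)).
  - by apply/measurable_EFinP; apply: measurable_funTS; exact: measurable_funM.
  - apply: ae_mono (ae_and (ae_neq 0) (ae_and (ae_neq a) (ae_neq b))) => x [x0 [xa xb]].
    rewrite /= in_itv/= => /andP[x0' xL]; apply: cvg_EFin; first exact: nearW.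
    apply: cvgM; last exact: cvg_cst.
    by apply: cvg_window => //; rewrite lt_def x0 x0'.
  - exact: integrable_abse iu.
  - apply: aeW => x n _; rewrite lee_fin normrM ger0_norm ?window_ge0//.
    by rewrite ler_piMl// window_le1.
  - move=> _ _ c; apply: (cvg_unique _ c); first exact: ereal_hausdorff.
    rewrite (_ : [sequence _]_n = cst 0%E); last by apply/funext => n; exact: wn.
    exact: cvg_cst.
(* The primitive of U from 0 vanishes on ]0, L[. *)
pose U := u \_ `[0, L[.
have iU : mu.-integrable setT (EFin \o U).
  by rewrite /U -restrict_EFin; exact: ((integrable_mkcond _ mI).1 iu).
have mU : measurable_fun setT U.
  by have /integrableP[/measurable_EFinP] := iU.
have F0 y : 0 < y < L -> \int[mu]_(t in `[0, y]) U t = 0.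
  move=> /andP[y0 yL]; rewrite /Rintegral.
  have -> : (\int[mu]_(t in `[0%R, y]) (U t)%:E = \int[mu]_(t in `]0%R, y[) (U t)%:E)%E.
    rewrite -integral_itv_bndo_bndc; last by apply/measurable_EFinP; exact: measurable_funTS.
    by rewrite integral_itv_obnd_cbnd//; apply/measurable_EFinP; exact: measurable_funTS.
  have -> : (\int[mu]_(t in `]0%R, y[) (U t)%:E =
             \int[mu]_(t in `[0%R, L[) (\1_(`]0%R, y[%classic) t * u t)%:E)%E.
    have -> : (`]0%R, y[%classic = `[0%R, L[%classic `&` `]0%R, y[%classic :> set R).
      apply/seteqP; split => t /=; rewrite !in_itv/=; last by move=> [].
      by move=> /andP[t0 ty]; rewrite t0 ty (ltW t0) (lt_trans ty).
    rewrite integral_mkcondr; apply: eq_integral => t tI.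
    rewrite epatch_indic/= /U patchE tI -EFinM mulrC; congr (_ * _)%:E.
    rewrite !indicE; congr ((nat_of_bool _)%:R).
    by rewrite in_setI tI.
  by rewrite zero// ltW.
have leb := lebesgue_differentiation (open_integrable_locally openT iU).
have H1 : {ae mu, forall x, `[0, L[%classic x -> g x ord0 i = velocity x ord0 i}.
  apply: ae_mono (ae_and leb (ae_neq 0)) => x [lx xN0]; rewrite /= in_itv/= => /andP[x0 xL].
  have {xN0}x0' : 0 < x by rewrite lt_def xN0.
  have x1 : x < x + 1 by rewrite ltrDl.
  have iUx : mu.-integrable [set` Interval (BLeft 0) (BRight (x + 1))] (EFin \o U).
    exact: integrableS iU.
  have ax : (BLeft 0%R < BRight x)%E by rewrite lte_fin.
  have [_] := FTC1_lebesgue_pt x1 iUx ax lx.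
  rewrite derive1E (@near_eq_derive _ _ _ _ (cst 0)); last first.
    near=> y; apply: F0; apply/andP; split; near: y.
    - exact: lt_nbhsr.
    - exact: lt_nbhsl.
  rewrite derive_cst /U patchE mem_set; last by rewrite /= in_itv/= x0.
  by rewrite /u => /esym/eqP; rewrite subr_eq0 => /eqP.
apply: ae_periodic H1 => x; rewrite gL (velocity_periodic hf); split; exact: id.
Unshelve. all: by end_near. Qed.

End WeakDerivative.

(** * Norms and seminorms of the velocity *)
Section Norms.
Context {R : realType}.
Local Notation mu := (@lebesgue_measure R).

Lemma ae_setX (P : R -> Prop) : {ae mu, forall s, P s} ->
  {ae (mu \x mu)%E, forall z : R * R, P z.1 /\ P z.2}.
Proof.
move=> [N [mN N0 PN]].
exists ((N `*` setT) `|` (setT `*` N)); split.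
- by apply: measurableU; exact: measurableX.
- have -> : ((mu \x mu) ((N `*` setT) `|` (setT `*` N)) = 0)%E.
    apply: null_set_setU => //; [exact: measurableX|exact: measurableX| |].
      by apply: (etrans (product_measure1E mu mu mN measurableT)); exact: (etrans (congr1 (fun x => x * _)%E N0) (mul0e _)).
    by apply: (etrans (product_measure1E mu mu measurableT mN)); exact: (etrans (congr1 (fun x => _ * x)%E N0) (mule0 _)).
  by [].
- move=> [s t] /= /not_andP[h|h]; [left|right]; split => //; exact: PN.
Qed.

Variables (L p : R) (Phi : R -> R).
Hypotheses (L0 : 0 < L) (p1 : 1 <= p).
Hypothesis Phi_ge0 : forall x : R, 0 <= x -> 0 <= Phi x.
Hypothesis Phi_meas : measurable_fun (`[0, +oo[ : set R) Phi.
Hypothesis Phi_0 : Phi 0 = 0.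
Context {d : nat}.
Variables (f : R -> 'rV[R]_d) (hf : arclength_embedded L f).
Local Notation weight := (weight p Phi).
Local Notation wint := (wint L p Phi).
Local Notation velocity := (velocity f).
Implicit Types (s t w c : R).

Let p0 : 0 < p. Proof. exact: lt_le_trans p1. Qed.
Let p20 : 0 < 2 * p. Proof. by rewrite mulr_gt0. Qed.

Lemma weight_Psi c : 0 <= c -> (Psi_of Phi p c `^ (2 * p))^-1 * c^-1 = weight c.
Proof.
rewrite le_eqVlt => /predU1P[<-|c0].
  by rewrite invr0 mulr0 /weight normr0 Phi_0 powR0 ?gt_eqF// invr0.
have P0 := Phi_ge0 (ltW c0).
rewrite /weight gtr0_norm// /Psi_of.
have D0 : 0 <= Phi c / c `^ p^-1 by rewrite divr_ge0// powR_ge0.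
rewrite -powRrM mulrA mulVf// mul1r powRM// ?invr_ge0 ?powR_ge0//.
rewrite powR_inv ?powR_ge0// -powRrM mulVf ?gt_eqF// powRr1 ?(ltW c0)//.
by rewrite invfM invrK mulfK// gt_eqF.
Qed.

(** The unfolding of the torus along its diagonal identifies the double integral
    of the seminorm with a weighted integral in the increment w. *)
Lemma seminormE (g : R -> 'rV[R]_d) : {ae mu, forall s, g s = velocity s} ->
  seminorm_Psi L (Psi_of Phi p) (2 * p) g = (wint (velocity_gap p f) `^ (2 * p)^-1)%E.
Proof.
move=> gv; rewrite /seminorm_Psi; congr (_ `^ _)%E.
have mg := jointly_measurable_velocity_gap p L0 hf.
have g0 := velocity_gap_ge0 p f.
pose F (z : R * R) := (weight (circ_dist L z.1 z.2) * enorm (velocity z.2 - velocity z.1) `^ (2 * p))%:E.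
have mF : measurable_fun setT F.
  apply/measurable_EFinP; apply: measurable_funM.
    by apply: (measurableT_comp (measurable_weight p Phi_meas)); exact: measurable_circ_dist.
  apply: (measurableT_comp (measurable_powR (2 * p))); apply: measurable_enorm => i.
  rewrite (_ : (fun z => _) = (fun z : R * R => velocity z.2 ord0 i - velocity z.1 ord0 i)); last first.
    by apply/funext => z; rewrite [LHS]mxE [X in _ + X]mxE.
  by apply: measurable_funB; apply: (measurableT_comp (velocity_measurable L0 hf i)).
have F0 z : (0 <= F z)%E.
  by rewrite lee_fin; apply: mulr_ge0; [exact: weight_ge0|exact: powR_ge0].
transitivity (\int[(mu \x mu)%E]_(z in `[0%R, L[ `*` `[0%R, L[) F z)%E.
  apply: ge0_ae_eq_integral_nomeas.
  - exact: measurableX.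
  - exact: measurable_funTS.
  - move=> z _; rewrite lee_fin mulr_ge0 ?invr_ge0 ?circ_dist_ge0//.
    by rewrite divr_ge0// powR_ge0.
  - by move=> z _; exact: F0.
  have [N [mN N0 HN]] := ae_setX gv.
  exists N; split => // z /= Hz; apply: HN => /= -[g1 g2]; apply: Hz => _.
  rewrite /F g1 g2 -mulrA weight_Psi 1?mulrC//.
  exact: circ_dist_ge0.
have FL s t : F (s, t + L) = F (s, t).
  have vt := velocity_periodic hf t.
  by rewrite /F (circ_distD L0) [(s, t + L).2]/= vt.
rewrite (ge0_integral_circle L0 mF F0 FL) (wintE L p Phi mg g0).
apply: eq_integral => w; rewrite inE/= in_itv/= => wI; apply: eq_integral => s _.
by rewrite /F/= circ_dist_shift// /weight normr_id.
Qed.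

Lemma norm_Lq_unit q (g : R -> 'rV[R]_d) : {ae mu, forall s, enorm (g s) = 1} ->
  norm_Lq L q g = (L `^ q^-1)%:E.
Proof.
move=> g1; rewrite /norm_Lq (@ge0_ae_eq_integral_nomeas _ _ _ mu `[0%R, L[%classic _ (cst 1%E))//.
- rewrite integral_cst//= mul1e lebesgue_measure_itv/= lte_fin L0 oppr0 adde0.
  by rewrite poweR_EFin.
- by move=> s _; rewrite lee_fin powR_ge0.
- by apply: ae_mono g1 => s -> _; rewrite powR1.
Qed.

Lemma in_Lq_velocity q : in_Lq L q velocity.
Proof.
split; first exact: velocity_periodic hf.
- by move=> i; exact: (velocity_measurable L0 hf i).
- rewrite norm_Lq_unit ?ltry//; apply: ae_mono (velocity_ae hf) => s [_ v1 _]; exact: v1.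
Qed.

Lemma in_Lq_curve q : 0 < q -> in_Lq L q f.
Proof.
move=> q0; split; first exact: curve_periodic hf.
- by move=> i; exact: (coordf_measurable L0 hf i).
- apply: poweR_lty; pose C := enorm (f 0) + L.
  have C0 : 0 <= C by rewrite addr_ge0 ?enorm_ge0// ltW.
  apply: (@le_lt_trans _ _ (\int[mu]_(s in `[0%R, L[) (cst (C `^ q)%:E s))%E).
    apply: ge0_le_integral_nomeas => s; first by move=> _; rewrite lee_fin powR_ge0.
    rewrite /= in_itv/= => /andP[s0 sL]; rewrite lee_fin.
    apply: ge0_ler_powR; rewrite ?nnegrE ?enorm_ge0 ?(ltW q0)//.
    have := curve_lip1 L0 hf 0 s; rewrite subr0 ger0_norm// => H.
    have := enormD (f 0) (f s - f 0); rewrite addrC subrK /C; lra.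
  by rewrite integral_cst//= lebesgue_measure_itv/= lte_fin L0 oppr0 adde0 -EFinM ltry.
Qed.

Lemma in_W1q_curve q : 0 < q -> in_Wkq L 1 q f.
Proof.
move=> q0; split; first exact: in_Lq_curve.
case=> [_|[_|//]].
  exists f; split; first exact: in_Lq_curve.
  by move=> eta _ _ i; rewrite derive1n0 expr0 mul1e.
by exists velocity; split; [exact: in_Lq_velocity|exact: (velocity_weak_deriv L0 hf)].
Qed.

End Norms.

(** * The characterization of finite energy *)
Lemma le_chain (R : realType) (a b c : R) (V T S E : \bar R) : 0 <= a -> 0 <= b -> 0 < c ->
  (V <= a%:E * T)%E -> (T <= b%:E * S)%E -> (c%:E * S <= E)%E -> (V <= (a * b / c)%:E * E)%E.
Proof.
move=> a0 b0 c0 VT TS SE.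
have SE' : (S <= (c^-1)%:E * E)%E.
  have h : ((c^-1)%:E * (c%:E * S) <= (c^-1)%:E * E)%E.
    by apply: lee_wpmul2l SE; rewrite lee_fin invr_ge0 ltW.
  by move: h; rewrite muleA -EFinM mulVf ?gt_eqF// mul1e.
apply: (le_trans VT); rewrite !EFinM -!muleA; apply: lee_wpmul2l; first by rewrite lee_fin.
apply: (le_trans TS); apply: lee_wpmul2l; first by rewrite lee_fin.
exact: SE'.
Qed.

(** The final estimate in abstract form: l is the norm of the velocity in L^q,
    S the power q of its seminorm and E the energy. The term l^q is a multiple
    of l, since l depends only on L and q. *)
Lemma norm_power_le (R : realType) (l q C : R) (S E : \bar R) : 0 < l -> 1 <= q -> 0 <= C ->
  (0 <= S)%E -> (0 <= E)%E -> (E < +oo)%E -> (S <= C%:E * E)%E ->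
  ((l%:E + S `^ q^-1) `^ q <= (2 `^ q * (C + l `^ q / l))%:E * (E + l%:E))%E.
Proof.
move=> l0 q1 C0 S0 E0 Efin SE.
have q0 : 0 < q by exact: lt_le_trans q1.
have Sfin : (S < +oo)%E.
  apply: le_lt_trans SE _; case: E E0 Efin => [r|//|//] r0 _.
  by rewrite -EFinM ltry.
case: E E0 Efin SE => [e|//|//]; case: S S0 Sfin => [s|//|//].
rewrite !lee_fin => s0 _ e0 _ se.
apply: (le_trans (powRD_le (ltW l0) (powR_ge0 _ _) (ltW q0))).
rewrite -powRrM mulVf ?gt_eqF// powRr1//.
rewrite -mulrA ler_pM2l ?powR_gt0//.
have -> : (C + l `^ q / l) * (e + l) = C * e + l `^ q + (l `^ q / l * e + C * l).
  by field; rewrite gt_eqF.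
have : 0 <= l `^ q / l * e by rewrite !mulr_ge0 ?powR_ge0 ?invr_ge0// ltW.
have : 0 <= C * l by rewrite mulr_ge0// ltW.
lra.
Qed.

(** Split the increment of the velocity into two deviations from the secant,
    bound these by iterated changes of scale, and the first change of scale by
    the energy. The ratio e, hence the constant, depends on L, p and Phi only. *)
Lemma velocity_gap_energy (R : realType) (L p : R) (Phi : R -> R)
  (L0 : 0 < L) (p1 : 1 <= p)
  (Phi_ge0 : forall x : R, 0 <= x -> 0 <= Phi x)
  (Phi_meas : measurable_fun (`[0, +oo[ : set R) Phi)
  (Phi_0 : Phi 0 = 0)
  (Phi_C1 : forall x : R, 0 < x ->
     derivable Phi x 1 /\ {for x, continuous (Phi^`()%classic)})
  (Phi_incr : forall x : R, 0 < x -> 0 < Phi^`()%classic x)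
  (Phi_A1 : exists K : R, 0 < K /\ log_slope Phi x @[x --> 0^'+] --> K)
  (phi : R -> R) (phi_ge0 : forall x : R, 0 <= x -> 0 <= phi x)
  (phi_scale : forall k x : R, 0 <= k -> 0 <= x -> Phi (k * x) <= phi k * Phi x)
  (Mfin : forall a : R, 0 < a -> (Mint phi p a < +oo)%E)
  (Mo : (fun e : R => fine (Mint phi p e)) =o_ (0^'+) (fun e : R => e)) :
  exists2 C : R, 0 <= C & forall (d : nat) (f : R -> 'rV[R]_d), arclength_embedded L f ->
    (wint L p Phi (velocity_gap p f) <= C%:E * energy Phi p L f)%E.
Proof.
have L20 : 0 < L / 2 by lra.
have [m [M [m0 _ mM]]] := log_slope_bounds Phi_ge0 Phi_C1 Phi_incr Phi_A1 L20.
have Hm x : 0 < x <= L / 2 -> m <= log_slope Phi x by move=> /mM /andP[].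
(* K is the loss in splitting the power 2p of a sum of two terms. *)
set K := 2 `^ (2 * p); have K0 : 0 < K by rewrite powR_gt0.
have eta0 : 0 < 2^-1 / K by rewrite divr_gt0.
have [e [e01 small]] := small_ratio Mfin Mo eta0.
have /andP[e0 e1] := e01.
have phie0 : 0 <= phi e by apply: phi_ge0; exact: ltW.
have small' : K * (phi e `^ p / e) <= 2^-1 by rewrite mulrC -ler_pdivlMr.
have me0 : 0 < m * e / 2 by rewrite divr_gt0// mulr_gt0.
have c0 : 0 < (m * e / 2) `^ p by rewrite powR_gt0.
exists (K * 2 * (2 * K) / (m * e / 2) `^ p) => [|d f hf].
  by rewrite divr_ge0 ?(ltW c0)// !mulr_ge0// ltW.
have H1 := velocity_increment_le L0 p1 Phi_meas hf.
have H2 := tangent_gap_le L0 p1 Phi_meas Phi_0 hf e01 (fun n =>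
  iterated_gap_le L0 p1 Phi_ge0 Phi_meas Phi_0 Phi_C1 Phi_incr hf n e01 phie0
    (fun x x0 => phi_scale e x (ltW e0) x0) small').
have H3 := energy_ge L0 p1 Phi_ge0 Phi_meas Phi_0 Phi_C1 Phi_incr hf m0 Hm e01.
exact: (le_chain _ _ c0 H1 H2 H3).
Qed.

Theorem theorem2p3 (R : realType) (L p : R) (Phi : R -> R)
  (L_gt0 : 0 < L) (p_ge1 : 1 <= p)
  (Phi_ge0 : forall x : R, 0 <= x -> 0 <= Phi x)
  (Phi_meas : measurable_fun (`[0, +oo[ : set R) Phi)
  (* (A0) *)
  (Phi_0 : Phi 0 = 0)
  (Phi_C1 : forall x : R, 0 < x ->
     derivable Phi x 1 /\ {for x, continuous (Phi^`()%classic)})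
  (Phi_incr : forall x : R, 0 < x -> 0 < Phi^`()%classic x)
  (* (A1) *)
  (Phi_A1 : exists K : R, 0 < K /\
     (x * Phi^`()%classic x / Phi x) @[x --> 0^'+] --> K)
  (* (A2) *)
  (Phi_A2 : exists phi : R -> R,
     [/\ measurable_fun (`[0, +oo[ : set R) phi,
         forall x : R, 0 <= x -> 0 <= phi x,
         forall k x : R, 0 <= k -> 0 <= x -> Phi (k * x) <= phi k * Phi x,
         forall a : R, 0 < a -> (Mint phi p a < +oo)%E
       & (fun e : R => fine (Mint phi p e)) =o_ (0^'+) (fun e : R => e)])
  (* (A3) *)
  (Phi_A3 : forall a : R, 0 < a ->
     (\int[lebesgue_measure]_(t in `]0%R, a])
        (t `^ (2 * p) / Phi t `^ p)%:E < +oo)%E) :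
  let Psi := Psi_of Phi p in
  (forall (d : nat) (f : R -> 'rV[R]_d), (0 < d)%N ->
     arclength_embedded L f ->
     in_WkPsi L 1 Psi (2 * p) f -> bilipschitz L f ->
     (energy Phi p L f < +oo)%E)
  /\
  (exists C : R, 0 < C /\
     forall (d : nat) (f : R -> 'rV[R]_d), (0 < d)%N ->
       arclength_embedded L f ->
       (energy Phi p L f < +oo)%E ->
       in_WkPsi L 1 Psi (2 * p) f /\
       (norm_WPsi L Psi (2 * p) (f^`()%classic) `^ (2 * p)%R <=
        C%:E * (energy Phi p L f + norm_Lq L (2 * p) (f^`()%classic)))%E).
Proof.
have p0 : 0 < p := lt_le_trans ltr01 p_ge1.
have q1 : 1 <= 2 * p by lra.
have q0 : 0 < 2 * p := lt_le_trans ltr01 q1.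
have [phi [phi_meas phi_ge0 phi_scale Mfin Mo]] := Phi_A2.
move=> Psi; split.
- move=> d f _ hf [_ [g [gLq gweak gPsi]]] [_ [Cb [Cb0 Hb]]].
  have L20 : 0 < L / 2 by lra.
  have [m [M [_ M0 mM]]] := log_slope_bounds Phi_ge0 Phi_C1 Phi_incr Phi_A1 L20.
  have HM x : 0 < x <= L / 2 -> log_slope Phi x <= M by move=> /mM /andP[].
  have Hb' s t : Cb * circ_dist L s t <= enorm (f t - f s).
    by rewrite -(intrinsic_distE L_gt0 hf).
  have gv := weak_deriv_unique L_gt0 hf q1 gLq gweak.
  have Wfin : (wint L p Phi (velocity_gap p f) < +oo)%E.
    move: gPsi; rewrite (seminormE L_gt0 p_ge1 Phi_ge0 Phi_meas Phi_0 hf gv).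
    by apply: lty_poweRy; rewrite invr_neq0// gt_eqF.
  exact: (energy_lty L_gt0 p_ge1 Phi_ge0 Phi_meas Phi_0 Phi_C1 Phi_incr
    phi_ge0 phi_meas phi_scale hf M0 Cb0 HM Hb' (Mfin 1 ltr01) Wfin).
- have [C0 C0_ge0 gap_le] := velocity_gap_energy L_gt0 p_ge1 Phi_ge0 Phi_meas
    Phi_0 Phi_C1 Phi_incr Phi_A1 phi_ge0 phi_scale Mfin Mo.
  pose l := L `^ (2 * p)^-1.
  have l0 : 0 < l by rewrite powR_gt0.
  exists (2 `^ (2 * p) * (C0 + l `^ (2 * p) / l)); split.
    by rewrite mulr_gt0 ?powR_gt0// ltr_wpDl// divr_gt0// powR_gt0.
  move=> d f _ hf Efin.
  have W0 : (0 <= wint L p Phi (velocity_gap p f))%E := wint_ge0 L p Phi (velocity_gap_ge0 p f).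
  have E0 : (0 <= energy Phi p L f)%E.
    by apply: integral_ge0 => z _; rewrite lee_fin powR_ge0.
  have WE := gap_le d f hf.
  have Wfin : (wint L p Phi (velocity_gap p f) < +oo)%E.
    apply: (le_lt_trans WE); move: E0 Efin; case: (energy _ _ _ _) => [r _ _|//|//].
    exact: ltry.
  split.
    split; first exact: in_W1q_curve.
    exists (velocity f); split.
    + exact: in_Lq_velocity.
    + exact: (velocity_weak_deriv L_gt0 hf).
    + rewrite (@seminormE _ _ _ _ L_gt0 p_ge1 Phi_ge0 Phi_meas Phi_0 _ _ hf (velocity f)).
        exact: poweR_lty.
      exact: aeW.
  have fv : {ae lebesgue_measure, forall s : R, (f^`()%classic) s = velocity f s}.
    by apply: ae_mono (velocity_ae hf) => s [-> _ _].
  have f1 : {ae lebesgue_measure, forall s : R, enorm ((f^`()%classic) s) = 1}.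
    by apply: ae_mono (curve_unit_speed hf) => s [].
  rewrite /norm_WPsi (seminormE L_gt0 p_ge1 Phi_ge0 Phi_meas Phi_0 hf fv).
  rewrite (norm_Lq_unit L_gt0 (2 * p) f1) -/l.
  exact: (norm_power_le l0 q1 C0_ge0 W0 E0 Efin WE).
Qed.
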